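(* Let $A$ and $B$ be irreducible square matrices with entries in $\{0,1\}$, of size greater than $1$ and not permutation matrices. There exists an isomorphism $\Phi:\mathcal{O}_A\rightarrow\mathcal{O}_B$ such that $$\Phi(\mathcal{D}_A)=\mathcal{D}_B\quad\text{and}\quad\Phi\circ\rho^A_t=\rho^B_t\circ\Phi\quad\text{for all }t\in\mathbb{R}/\mathbb{Z}$$ if and only if $(X_A,\sigma_A)$ and $(X_B,\sigma_B)$ are eventually one-sided conjugate.
   Context: For an $N\times N$ matrix $A$ with entries in $\{0,1\}$, irreducible, $N>1$, not a permutation matrix: $X_A=\{(x_n)_{n\in\mathbb{N}}\in\{1,\dots,N\}^{\mathbb{N}}\mid A(x_n,x_{n+1})=1 \text{ for all } n\}$ with the relative product topology, and $\sigma_A((x_n)_n)=(x_{n+1})_n$. $\mathcal{O}_A$ (Cuntz--Krieger algebra) is the universal unital $C^*$-algebra generated by partial isometries $S_1,\dots,S_N$ with $\sum_{j}S_jS_j^*=1$ and $S_i^*S_i=\sum_{j}A(i,j)S_jS_j^*$. $\mathcal{D}_A\subset\mathcal{O}_A$ is the $C^*$-subalgebra generated by the projections $S_{i_1}\cdots S_{i_n}S_{i_n}^*\cdots S_{i_1}^*$. The gauge action $\rho^A$ of $\mathbb{R}/\mathbb{Z}$ on $\mathcal{O}_A$ is given by $\rho^A_t(S_i)=e^{2\pi\sqrt{-1}t}S_i$. The same notation is used for $B$. $(X_A,\sigma_A)$ and $(X_B,\sigma_B)$ are eventually one-sided conjugate if there exist a homeomorphism $h:X_A\to X_B$ and continuous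 functions $k_1:X_A\to\mathbb{Z}_+$, $k_2:X_B\to\mathbb{Z}_+$ (nonnegative integers) such that $\sigma_B^{k_1(x)}(h(\sigma_A(x)))=\sigma_B^{k_1(x)+1}(h(x))$ for all $x\in X_A$ and $\sigma_A^{k_2(y)}(h^{-1}(\sigma_B(y)))=\sigma_A^{k_2(y)+1}(h^{-1}(y))$ for all $y\in X_B$. *)

(* Defs.v *)
From HB Require Import structures.
From mathcomp Require Import all_boot all_order all_algebra.
From mathcomp Require Import complex.
From mathcomp Require Import all_classical all_reals all_analysis.

Set Implicit Arguments.
Unset Strict Implicit.
Unset Printing Implicit Defensive.

Import Order.TTheory GRing.Theory Num.Theory.
Import numFieldNormedType.Exports.

Local Open Scope classical_set_scope.
Local Open Scope ring_scope.

(* Unital C*-algebras.  The norm of a normed module over R[i] takes its values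
   in R[i] (as nonnegative reals).  The product is a field of the mixin because
   Hierarchy Builder rejects the join of [GRing.Algebra] and [NormedModule]; the
   algebra structure is attached to [CStarAlgebra.sort] right below. *)
HB.mixin Record isCStarAlgebra (R : realType) A
    & CompleteNormedModule R[i] A := {
  cmul : A -> A -> A;
  cone : A;
  star : A -> A;
  cmulA : associative cmul;
  cmul1x : left_id cone cmul;
  cmulx1 : right_id cone cmul;
  cmulDl : left_distributive cmul +%R;
  cmulDr : right_distributive cmul +%R;
  cone_neq0 : cone != 0;
  cscaleAl : forall (a : R[i]) x y, a *: cmul x y = cmul (a *: x) y;
  cscaleAr : forall (a : R[i]) x y, a *: cmul x y = cmul x (a *: y);
  starK : involutive star;
  starD : forall x y, star (x + y) = star x + star y;
  starZ : forall (a : R[i]) x, star (a *: x) = conjc a *: star x;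
  starcmul : forall x y, star (cmul x y) = cmul (star y) (star x);
  norm_cmul : forall x y, `|cmul x y| <= `|x| * `|y| :> R[i];
  norm_star_cmul : forall x, `|cmul (star x) x| = `|x| ^+ 2 :> R[i]
}.

#[short(type="cstarAlgType")]
HB.structure Definition CStarAlgebra (R : realType) :=
  {A of CompleteNormedModule R[i] A & isCStarAlgebra R A}.

Section CStarAlgebraRing.
Variables (R : realType) (A : cstarAlgType R).

#[non_forgetful_inheritance]
HB.instance Definition _ := GRing.Zmodule_isNzRing.Build (CStarAlgebra.sort A)
  cmulA cmul1x cmulx1 cmulDl cmulDr cone_neq0.

#[non_forgetful_inheritance]
HB.instance Definition _ :=
  GRing.Lmodule_isLalgebra.Build R[i] (CStarAlgebra.sort A) cscaleAl.

#[non_forgetful_inheritance]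
HB.instance Definition _ :=
  GRing.Lalgebra_isAlgebra.Build R[i] (CStarAlgebra.sort A) cscaleAr.

Implicit Types x y : A.

Lemma starM x y : star (x * y) = star y * star x.
Proof. exact: starcmul. Qed.

Lemma norm_submul x y : `|x * y| <= `|x| * `|y| :> R[i].
Proof. exact: norm_cmul. Qed.

Lemma cstar_identity x : `|star x * x| = `|x| ^+ 2 :> R[i].
Proof. exact: norm_star_cmul. Qed.

End CStarAlgebraRing.

Section CStar.
Context {R : realType}.
Implicit Types A B : cstarAlgType R.

(* [{lrmorphism A -> B}] is the type of unital C-algebra homomorphisms. *)
Definition star_preserving {A B} (f : A -> B) :=
  forall x, f (star x) = star (f x).

Definition cstar_subalgebra {A} (D : set A) : Prop :=
  [/\ D 0,
      forall (a : R[i]) x y, D x -> D y -> D (a *: x + y),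
      forall x y, D x -> D y -> D (x * y),
      forall x, D x -> D (star x)
    & closed D].

Definition cstar_generated {A} (G : set A) : set A := smallest cstar_subalgebra G.

Lemma star0 A : star (0 : A) = 0.
Proof. by rewrite -[in LHS](scale0r (0 : A)) starZ conjc0 scale0r. Qed.

Lemma star_sum A (I : Type) (r : seq I) (P : pred I) (F : I -> A) :
  star (\sum_(i <- r | P i) F i) = \sum_(i <- r | P i) star (F i).
Proof. by apply: big_morph; [exact: starD | exact: star0]. Qed.

End CStar.

Section ZeroOneMatrices.
Context {N : nat}.
Implicit Type A : 'M[nat]_N.

Definition zero_one_mx A := forall i j, A i j \in [:: 0%N; 1%N].

Definition irreducible_mx A :=
  forall i j, exists2 n, (0 < n)%N & (0 < (A ^+ n) i j)%N.

End ZeroOneMatrices.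

Section CuntzKrieger.
Context {R : realType} {N : nat} (M : 'M[nat]_N).

Definition CK_family {A : cstarAlgType R} (S : 'I_N -> A) : Prop :=
  [/\ forall i, S i * star (S i) * S i = S i,
      \sum_j S j * star (S j) = 1
    & forall i, star (S i) * S i = \sum_j (S j * star (S j)) *+ M i j].

(* The universal unital C*-algebra generated by a Cuntz-Krieger family; it is
   determined by [M] up to a unique isomorphism matching the generators. *)
Record CK_algebra := CKAlgebra {
  CK_carrier :> cstarAlgType R;
  CK_gen : 'I_N -> CK_carrier;
  CK_genP : CK_family CK_gen;
  CK_generated : cstar_generated (range CK_gen) = setT;
  CK_universal : forall (B : cstarAlgType R) (T : 'I_N -> B), CK_family T ->
    exists f : {lrmorphism CK_carrier -> B},
      [/\ star_preserving f,
          forall i, f (CK_gen i) = T i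
        & forall g : {lrmorphism CK_carrier -> B},
            star_preserving g -> (forall i, g (CK_gen i) = T i) -> g =1 f]
}.

(* e^(2 pi sqrt(-1) t) *)
Definition circle_exp (t : R) : R[i] :=
  Complex (cos (2 * pi * t)) (sin (2 * pi * t)).

Lemma circle_exp_conj t : conjc (circle_exp t) * circle_exp t = 1.
Proof.
rewrite /circle_exp /= /GRing.mul /= mulNr opprK -!expr2 cos2Dsin2.
by rewrite mulNr [sin _ * _]mulrC subrr.
Qed.

Lemma circle_expD1 t : circle_exp (t + 1) = circle_exp t.
Proof.
rewrite /circle_exp mulrDr mulr1 mulr_natl.
by rewrite -[pi *+ 2]mulr2n cosD2pi sinD2pi.
Qed.

Lemma CK_family_rotate (A : cstarAlgType R) (S : 'I_N -> A) (t : R) :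
  CK_family S -> CK_family (fun i => circle_exp t *: S i).
Proof.
case=> pS sS rS; set c := circle_exp t.
have cc : c * conjc c = 1 by rewrite mulrC circle_exp_conj.
have E j : c *: S j * star (c *: S j) = S j * star (S j).
  by rewrite starZ -scalerAl -scalerAr scalerA cc scale1r.
have E' j : star (c *: S j) * (c *: S j) = star (S j) * S j.
  by rewrite starZ -scalerAl -scalerAr scalerA circle_exp_conj scale1r.
split=> [i||i].
- by rewrite E -scalerAr pS.
- by under eq_bigr do rewrite E.
- by rewrite E' rS; under [RHS]eq_bigr do rewrite E.
Qed.

Variable O : CK_algebra.

Lemma gauge_exists (t : R) : exists f : {lrmorphism O -> O},
  star_preserving f /\ forall i, f (CK_gen O i) = circle_exp t *: CK_gen O i.
Proof.
have [f [fs fg _]] :=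
  CK_universal O (CK_family_rotate t (CK_genP O)).
by exists f.
Qed.

(* An action of R/Z, given as a 1-periodic function of t : R, see [gaugeD1]. *)
Definition gauge (t : R) : {lrmorphism O -> O} := projT1 (cid (gauge_exists t)).

Lemma gauge_star t : star_preserving (gauge t).
Proof. by rewrite /gauge; case: cid => f []. Qed.

Lemma gauge_gen t i : gauge t (CK_gen O i) = circle_exp t *: CK_gen O i.
Proof. by rewrite /gauge; case: cid => f []. Qed.

Lemma gauge_unique t (f : {lrmorphism O -> O}) : star_preserving f ->
  (forall i, f (CK_gen O i) = circle_exp t *: CK_gen O i) -> f =1 gauge t.
Proof.
move=> fs fg.
have [g [_ _ U]] := CK_universal O (CK_family_rotate t (CK_genP O)).
move=> x; rewrite (U f fs fg x); apply/esym/U; first exact: gauge_star.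
exact: gauge_gen.
Qed.

Lemma gaugeD1 t : gauge (t + 1) =1 gauge t.
Proof.
apply: gauge_unique; first exact: gauge_star.
by move=> i; rewrite gauge_gen circle_expD1.
Qed.

Definition CK_word (w : seq 'I_N) : O := \prod_(i <- w) CK_gen O i.

Definition CK_diagonal : set O :=
  cstar_generated
    [set p | exists2 w, w != [::] & p = CK_word w * star (CK_word w)].

End CuntzKrieger.

Arguments gauge {R N M} O t.
Arguments CK_diagonal {R N M} O.

Section MarkovShift.
Context {N : nat} (M : 'M[nat]_N).

Definition admissible : set {ptws nat -> discrete_topology 'I_N} :=
  [set x | forall n, M (x n) (x n.+1) = 1%N].

(* The subtype of admissible sequences, with the relative topology. *)
Definition shift_space := set_type admissible.
HB.instance Definition _ := Topological.on shift_space.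

Definition shift_seq (x : {ptws nat -> discrete_topology 'I_N}) :
  {ptws nat -> discrete_topology 'I_N} := fun n => x n.+1.

Lemma shift_admissible (x : shift_space) :
  shift_seq (set_val x) \in admissible.
Proof. by apply/mem_set => n; exact: (set_mem (valP x)). Qed.

Definition shift (x : shift_space) : shift_space := SigSub (shift_admissible x).

End MarkovShift.

Definition eventually_conjugate (N1 N2 : nat)
    (A : 'M[nat]_N1) (B : 'M[nat]_N2) : Prop :=
  exists (h : shift_space A -> shift_space B)
         (h' : shift_space B -> shift_space A)
         (k1 : shift_space A -> nat) (k2 : shift_space B -> nat),
  [/\ [/\ cancel h h', cancel h' h, continuous h & continuous h'],
      continuous k1, continuous k2,
      forall x, iter (k1 x) (@shift _ B) (h (shift x)) =
                iter (k1 x).+1 (@shift _ B) (h x)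
    & forall y, iter (k2 y) (@shift _ A) (h' (shift y)) =
                iter (k2 y).+1 (@shift _ A) (h' y)].

(* Main.v *)
Require Import Defs.
From HB Require Import structures.
From mathcomp Require Import all_boot all_order all_algebra.
From mathcomp Require Import complex.
From mathcomp Require Import all_classical all_reals all_analysis.
From mathcomp Require Import ring lra zify.

(** Write [S i] for the generators, [S w] for their product along a word [w] and
    [P w] for the projection [S w * star (S w)], which stands for the cylinder of
    [w] in the shift space.

    From a conjugacy to an isomorphism.  A set [E] of pairs of points which is
    defined by finitely many letters of both, and whose pairs have a common tail
    after [a] and [b] shifts respectively, is a finite union of sets of pairs
    [(v z, u z)].  The corresponding sum of elements [S v * star (S u)] depends only
    on [E] and on the degree [a - b]; it turns composition of relations into
    products, inversion into adjoints and disjoint unions into sums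
    ([realizes_comp], [realizes_inverse], [realizes_sum]).  The generator [S i]
    belongs to the inverse branch of the shift that puts [i] in front of a point.  An
    eventual conjugacy [h], by uniform continuity, carries this relation to one of
    the same kind on the other side ([transport_branch_level]), and the elements
    attached to the carried relations form a Cuntz-Krieger family, because the
    Cuntz-Krieger relations express identities between relations on points
    ([transfer_CK_family]).  The universal property gives a homomorphism, and
    carrying relations forth and back shows that the homomorphisms attached to [h]
    and to its inverse are inverse to each other ([implements_inverse]).  Gauge
    equivariance is the fact that the images of the generators have degree one, and
    the image of [P w] belongs to a part of the identity relation, hence to the
    diagonal.

    From an isomorphism to a conjugacy.  A projection of the diagonal is constant, 0
    or 1, on all sufficiently small cylinders ([diagonal_projection]), so an
    isomorphism of the diagonals induces a homeomorphism [h] of the shift spaces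
    ([dual_point], [dual_cancel]).  The image [T] of [S i] has gauge degree one.  It
    is at distance less than 1 from a linear combination of elements
    [S v * star (S u)], and averaging over the gauge action makes all its terms
    satisfy [size v = (size u).+1].  If [h x] and [h (shift x)] were not
    synchronised after as many steps as the longest [u] has letters, such a
    combination would vanish between small cylinders around these two points
    ([degree_one_lag]), while [T] has norm 1 there ([dual_lag]).

    Two facts on C*-algebras are needed: homomorphisms are contractive
    ([starhom_contractive]), and projections with sum 1 are orthogonal
    ([projection_sum1_orth]).  Both are derived from the square root of [1 - x] for
    a self-adjoint [x] of norm less than 1 ([sqrt_one_minus]), which a fixed-point
    iteration provides. *)

Set Implicit Arguments.
Unset Strict Implicit.
Unset Printing Implicit Defensive.

Import Order.TTheory GRing.Theory Num.Theory.
Import numFieldNormedType.Exports.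

Local Open Scope classical_set_scope.
Local Open Scope ring_scope.

(** * The norm of a C*-algebra *)

Section RealNorm.
Context {R : realType} {A : cstarAlgType R}.
Implicit Types (x y z : A) (r : R).

(** The norm of a normed module over [R[i]] has its values in [R[i]], which is only
    partially ordered; estimates are done with its real part. *)
Definition nrm x : R := complex.Re (`|x| : R[i]).

Lemma real_complex_gt0 r : (0 < r%:C%C :> R[i]) = (0 < r).
Proof. by rewrite -ltcR. Qed.

Lemma nrmE x : `|x| = (nrm x)%:C%C.
Proof. by rewrite /nrm RRe_real// normr_real. Qed.

Lemma nrm_ge0 x : 0 <= nrm x.
Proof. by rewrite -ler0c -nrmE. Qed.

Lemma nrmD x y : nrm (x + y) <= nrm x + nrm y.
Proof. by rewrite -lecR rmorphD/= -!nrmE ler_normD. Qed.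

Lemma nrmN x : nrm (- x) = nrm x.
Proof. by rewrite /nrm normrN. Qed.

Lemma nrmB x y : nrm (x - y) <= nrm x + nrm y.
Proof. by rewrite -[nrm y]nrmN nrmD. Qed.

Lemma nrmBC x y : nrm (x - y) = nrm (y - x).
Proof. by rewrite -nrmN opprB. Qed.

Lemma nrm_split y x z : nrm (x - z) <= nrm (x - y) + nrm (y - z).
Proof. by rewrite -[x - z](subrKA y) nrmD. Qed.

Lemma nrmM x y : nrm (x * y) <= nrm x * nrm y.
Proof. by rewrite -lecR rmorphM/= -!nrmE; exact: norm_submul. Qed.

Lemma nrm0 : nrm (0 : A) = 0.
Proof. by rewrite /nrm normr0. Qed.

Lemma nrm_eq0 x : nrm x = 0 -> x = 0.
Proof. by move=> x0; apply/eqP; rewrite -normr_eq0 nrmE x0. Qed.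

Lemma nrmZ (a : R[i]) x : nrm (a *: x) = complex.Re `|a| * nrm x.
Proof.
by apply: complexI; rewrite -nrmE normrZ rmorphM/= -nrmE.
Qed.

Lemma nrmZr r x : nrm (r%:C%C *: x) = `|r| * nrm x.
Proof. by rewrite nrmZ normc_def/= expr0n/= addr0 sqrtr_sqr. Qed.

Lemma nrmMn x n : nrm (x *+ n) = nrm x *+ n.
Proof. by rewrite -scaler_nat -(rmorph_nat (@real_complex_def R _)) nrmZr normr_nat mulr_natl. Qed.

Lemma nrm_cstar x : nrm (star x * x) = nrm x ^+ 2.
Proof. by apply: complexI; rewrite -nrmE cstar_identity nrmE rmorphXn. Qed.

Lemma nrm_sum (I : Type) (s : seq I) (P : pred I) (F : I -> A) :
  nrm (\sum_(i <- s | P i) F i) <= \sum_(i <- s | P i) nrm (F i).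
Proof.
elim/big_rec2: _ => [|i y1 y2 _ le12]; first by rewrite nrm0.
exact: le_trans (nrmD _ _) (lerD _ _).
Qed.

Lemma nrm_star x : nrm (star x) = nrm x.
Proof.
have le_star z : nrm z <= nrm (star z).
  have [->|z0] := eqVneq (nrm z) 0; first exact: nrm_ge0.
  have zgt : 0 < nrm z by rewrite lt_neqAle eq_sym z0 nrm_ge0.
  by rewrite -(ler_pM2r zgt) -expr2 -nrm_cstar nrmM.
by apply/eqP; rewrite eq_le le_star -{2}[x]starK le_star.
Qed.

Lemma starN x : star (- x) = - star x.
Proof. by rewrite -scaleN1r starZ rmorphN1 scaleN1r. Qed.

Lemma starB x y : star (x - y) = star x - star y.
Proof. by rewrite starD starN. Qed.

Lemma star1 : star (1 : A) = 1.
Proof. by rewrite -[LHS]mulr1 -{2}[1]starK -starM mulr1 starK. Qed.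

Lemma starMn x n : star (x *+ n) = star x *+ n.
Proof. by elim: n => [|n IH]; rewrite ?mulr0n ?star0// !mulrS starD IH. Qed.

Lemma starZr r x : star (r%:C%C *: x) = r%:C%C *: star x.
Proof. by rewrite starZ conjc_real. Qed.

Definition projection x := star x = x /\ x * x = x.

Lemma nrm_projection x : projection x -> x != 0 -> nrm x = 1.
Proof.
case=> sx xx x0; have := nrm_cstar x; rewrite sx xx expr2 => /eqP.
rewrite -[X in X == _]mul1r (inj_eq (mulIf _)) => [/eqP->//|].
by apply: contra_neq x0 => /nrm_eq0.
Qed.

Lemma nrm_projection_le1 x : projection x -> nrm x <= 1.
Proof.
by move=> px; have [->|/(nrm_projection px)->//] := eqVneq x 0; rewrite nrm0.
Qed.

Lemma projection1 : projection (1 : A). Proof. by split; rewrite ?star1 ?mulr1. Qed.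

Lemma nrm1 : nrm (1 : A) = 1.
Proof. by apply: nrm_projection; [exact: projection1 | exact: oner_neq0]. Qed.

Lemma projectionM x y : projection x -> projection y -> x * y = y * x -> projection (x * y).
Proof.
move=> [sx xx] [sy yy] xy; split; first by rewrite starM sx sy.
by rewrite mulrA -(mulrA x) -xy mulrA xx -mulrA yy.
Qed.

Lemma projectionB e x : projection e -> projection x -> e * x = x -> x * e = x -> projection (e - x).
Proof.
move=> [se ee] [sx xx] ex xe; split; first by rewrite starB se sx.
by rewrite mulrBl !mulrBr ee xx ex xe subrr subr0.
Qed.

Lemma closed_nrmP (D : set A) :
  closed D <-> forall x, (forall e : R, 0 < e -> exists2 y, D y & nrm (x - y) < e) -> D x.
Proof.
rewrite closure_id; split=> [clD x xD|cD].
  rewrite clD => B /nbhs_normP[e /= e0 eB].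
  have eE : e = (complex.Re e)%:C%C by rewrite RRe_real// gtr0_real.
  have [|y Dy xy] := xD (complex.Re e); first by rewrite -real_complex_gt0 -eE.
  by exists y; split=> //; apply: eB; rewrite /= nrmE eE ltcR.
apply/seteqP; split; first exact: subset_closure.
move=> x xD; apply: cD => e e0.
have [|y [Dy]] := xD (ball_ Num.Def.normr x e%:C%C).
  by apply/nbhs_normP; exists e%:C%C; rewrite //= real_complex_gt0.
by rewrite /ball_ /= nrmE ltcR => xy; exists y.
Qed.

(** Stated for geometrically decreasing steps, which is what iterating a contraction
    produces. *)
Lemma geometric_cauchy_cvg (u : nat -> A) r C : 0 <= r < 1 ->
  (forall n, nrm (u n.+1 - u n) <= C * r ^+ n) ->
  exists l, forall e : R, 0 < e -> exists n0, forall n, (n0 <= n)%N -> nrm (l - u n) < e.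
Proof.
move=> /andP[r0 r1] uC.
have C0 : 0 <= C.
  by have := le_trans (nrm_ge0 _) (uC 0%N); rewrite expr0 mulr1.
have r1' : 0 < 1 - r by rewrite subr_gt0.
have tail n m : nrm (u (n + m)%N - u n) <= C / (1 - r) * r ^+ n.
  suff : nrm (u (n + m)%N - u n) <= C / (1 - r) * (r ^+ n - r ^+ (n + m)).
    move/le_trans; apply; apply: ler_wpM2l; first by rewrite divr_ge0// ltW.
    by rewrite gerBl exprn_ge0.
  elim: m => [|m IH]; first by rewrite addn0 !subrr nrm0 mulr0.
  apply: le_trans (nrm_split (u (n + m)%N) _ _) _; rewrite addnS.
  apply: le_trans (lerD (uC _) IH) _; rewrite exprS.
  rewrite le_eqVlt; apply/orP; left; apply/eqP.
  by field; rewrite gt_eqF.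
have small e : 0 < e -> exists n0, forall n, (n0 <= n)%N -> C / (1 - r) * r ^+ n < e.
  move=> e0; have := @cvg_geometric R (C / (1 - r)) r.
  rewrite ger0_norm// => /(_ r1)/cvgrPdist_lt/(_ e e0)[n0 _ n0P].
  exists n0 => n /n0P /=; rewrite sub0r normrN ger0_norm//.
  by rewrite mulr_ge0 ?exprn_ge0// divr_ge0// ltW.
have : cvgn (u : nat -> A).
  apply: cauchy_cvg; apply: cauchy_exP => e e0.
  have eE : e = (complex.Re e)%:C%C by rewrite RRe_real// gtr0_real.
  have [|n0 n0P] := small (complex.Re e); first by rewrite -real_complex_gt0 -eE.
  exists (u n0); exists n0 => // n /= le_n; rewrite -ball_normE /= nrmE eE ltcR.
  rewrite -(subnKC le_n) nrmBC; apply: le_lt_trans (tail _ _) _.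
  exact: n0P.
move=> /cvgrPdist_lt cu; exists (lim (u @ \oo)) => e e0.
have [|n0 _ n0P] := cu e%:C%C; first by rewrite real_complex_gt0.
by exists n0 => n /n0P /=; rewrite nrmE ltcR.
Qed.

End RealNorm.

(** * Square roots and contractive homomorphisms *)

Section SquareRoot.
Context {R : realType} {A : cstarAlgType R}.
Implicit Types (x y z : A) (r : R).

(** With [b = 1 - y] the equation [b * b = 1 - x] becomes the fixed-point
    equation [y = (x + y * y) / 2], whose right-hand side maps the ball of radius
    [nrm x] to itself and contracts it by the factor [nrm x].  Self-adjointness
    and commutation pass from the iterates to the limit. *)
Lemma sqrt_one_minus x : star x = x -> nrm x < 1 ->
  exists b, [/\ star b = b, b * b = 1 - x
    & forall z, z * x = x * z -> z * b = b * z].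
Proof.
move=> sx x1; pose h : R[i] := (2^-1 : R)%:C%C.
have h2 y : h *: (y + y) = y.
  rewrite -mulr2n -scaler_nat scalerA -(rmorph_nat (@real_complex_def R _)).
  by rewrite -rmorphM/= mulVf ?pnatr_eq0// scale1r.
have nh y : nrm (h *: y) = nrm y / 2.
  by rewrite nrmZr ger0_norm ?invr_ge0// mulrC.
pose F y := h *: (x + y * y); pose u n := iter n F 0.
have F_lip y z : nrm (F y - F z) <= (nrm y + nrm z) / 2 * nrm (y - z).
  rewrite /F -scalerBr nh [x + _]addrC addrKA.
  have -> : y * y - z * z = y * (y - z) + (y - z) * z.
    by rewrite mulrBr mulrBl addrA subrK.
  rewrite mulrAC ler_wpM2r ?invr_ge0//.
  apply: le_trans (nrmD _ _) _; rewrite [leRHS]mulrDl.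
  by apply: lerD; [|rewrite [leRHS]mulrC]; exact: nrmM.
have u_le n : nrm (u n) <= nrm x.
  elim: n => [|n IH] /=; first by rewrite nrm0 nrm_ge0.
  rewrite nh; apply: le_trans (_ : (nrm x + nrm x) / 2 <= _); last by lra.
  rewrite ler_wpM2r ?invr_ge0//; apply: le_trans (nrmD _ _) _; rewrite lerD2l.
  apply: le_trans (nrmM _ _) _; rewrite -[leRHS]mulr1.
  by apply: ler_pM; rewrite ?nrm_ge0// (le_trans IH)// ltW.
have [|n|l ul] := @geometric_cauchy_cvg R A u (nrm x) 1; first by rewrite nrm_ge0.
  rewrite mul1r; elim: n => [|n IH]; first by rewrite expr0 subr0 (le_trans (u_le 1%N))// ltW.
  rewrite exprS [u n.+2]/(u _)/=; apply: le_trans (F_lip _ _) _.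
  apply: ler_pM; rewrite ?nrm_ge0//.
    by rewrite divr_ge0// addr_ge0 ?nrm_ge0.
  by have := u_le n; have := u_le n.+1; rewrite /u /=; lra.
have l_eq y z : (forall e : R, 0 < e -> nrm (y - z) <= e) -> y = z.
  move=> yz; apply/eqP; rewrite -subr_eq0; apply/eqP/nrm_eq0/eqP.
  by rewrite eq_le nrm_ge0 andbT; apply/ler_addgt0Pl => e /yz; rewrite addr0.
have sl : star l = l.
  apply: l_eq => e e0.
  have [|n /(_ n (leqnn n)) ln] := ul (e / 2); first by lra.
  have su : star (u n) = u n.
    elim: (n) => [|k IH]; first exact: star0.
    by rewrite /= starZr starD sx starM IH.
  apply: le_trans (nrm_split (u n) _ _) _.
  by rewrite -{1}su -starB nrm_star (nrmBC (u n)); lra.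
have Fl : F l = l.
  apply: l_eq => e e0.
  (* The distance of [F l] and [u n.+1 = F (u n)] is at most
     [(nrm l + nrm x) / 2 * nrm (l - u n)]. *)
  have [|n n0] := ul (Num.min 1 (e / (nrm l + nrm x + 2))).
    rewrite lt_min ltr01 divr_gt0//.
    by have := nrm_ge0 l; have := nrm_ge0 x; lra.
  have := n0 n (leqnn n); have := n0 n.+1 (leqnSn n).
  set D := nrm l + nrm x + 2.
  have D0 : 2 <= D by rewrite /D; have := nrm_ge0 l; have := nrm_ge0 x; lra.
  rewrite !lt_min !ltr_pdivlMr; [|lra|lra].
  move=> /andP[_ lS] /andP[_ ln].
  apply: le_trans (nrm_split (u n.+1) _ _) _.
  rewrite (nrmBC _ l).
  have := F_lip l (u n); rewrite -[F (u n)]/(u n.+1).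
  have := u_le n; have := nrm_ge0 l; have := nrm_ge0 (u n).
  move: lS ln; rewrite /D; have := nrm_ge0 (l - u n); have := nrm_ge0 (l - u n.+1).
  have := nrm_ge0 x.
  nra.
exists (1 - l); split=> [||z zx].
- by rewrite starB star1 sl.
- have -> : x = l + l - l * l.
    by rewrite -{1 2}Fl /F -scalerDr h2 addrK.
  by rewrite mulrBl mul1r mulrBr mulr1 !opprB addrACA -opprD addrA.
rewrite mulrBr mulrBl mulr1 mul1r; congr (_ - _).
apply: l_eq => e e0.
have [|n /(_ n (leqnn n)) ln] := ul (e / (2 * (nrm z + 1))).
  by rewrite divr_gt0//; have := nrm_ge0 z; lra.
have zu : z * u n = u n * z.
  elim: (n) => [|k IH]; first by rewrite mulr0 mul0r.
  rewrite /= -scalerAr -scalerAl mulrDr mulrDl zx; congr (_ *: (_ + _)).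
  by rewrite mulrA IH -mulrA IH mulrA.
apply: le_trans (nrm_split (z * u n) _ _) _.
rewrite -mulrBr zu -mulrBl.
have := nrmM z (l - u n); have := nrmM (u n - l) z.
rewrite (nrmBC _ l); move: ln; rewrite ltr_pdivlMr.
  by have := nrm_ge0 z; have := nrm_ge0 (l - u n); nra.
by have := nrm_ge0 z; lra.
Qed.

End SquareRoot.

Section Cartesian.
Context {R : realType} {A : cstarAlgType R}.
Implicit Types (a b e f x y : A) (r : R).

Lemma star_cartesian a b : star a = a -> star b = b ->
  star (a + 'i%C *: b) = a - 'i%C *: b.
Proof.
move=> sa sb; rewrite starD starZ sa sb -scaleNr; congr (_ + _ *: _).
by apply/eqP; rewrite eq_complex /= oppr0 !eqxx.
Qed.

Lemma cartesian_sq a b : star a = a -> star b = b -> a * b = b * a ->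
  star (a + 'i%C *: b) * (a + 'i%C *: b) = a * a + b * b.
Proof.
move=> sa sb ab; rewrite star_cartesian// mulrBl !mulrDr.
have ii : 'i%C * 'i%C = -1 :> R[i] by rewrite -expr2; exact: sqr_i.
by rewrite -!scalerAr -!scalerAl ab scalerA ii scaleN1r opprD opprK addrA addrK.
Qed.

(** Twice a self-adjoint real part is the sum of an element and its adjoint, which
    have the same norm. *)
Lemma nrm_re_le a b : star a = a -> star b = b -> nrm a <= nrm (a + 'i%C *: b).
Proof.
move=> sa sb; have := nrmD (a + 'i%C *: b) (star (a + 'i%C *: b)).
rewrite nrm_star star_cartesian// addrACA subrr addr0 -mulr2n nrmMn.
by rewrite -mulr2n lerMn2r.
Qed.

Lemma nrm_im_le a b : star a = a -> star b = b -> nrm b <= nrm (a + 'i%C *: b).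
Proof.
move=> sa sb; have := nrmB (a + 'i%C *: b) (star (a + 'i%C *: b)).
rewrite nrm_star star_cartesian// opprB addrC subrKA -mulr2n nrmMn.
rewrite -mulr2n lerMn2r/= nrmZ normc_def /= expr0n expr1n add0r sqrtr1.
by rewrite mul1r.
Qed.

(** For [r < 1] the element [e - r *: (e + f * f)] has a self-adjoint square root
    [b] in the corner of [e], which commutes with [f].  Hence [b + i sqrt r f] has
    modulus squared [b * b + r *: (f * f) = (1 - r) *: e], which bounds [f] and
    tends to zero as [r] tends to 1. *)
Lemma corner_extreme_sq e f : projection e -> star f = f -> e * f = f ->
  nrm (e + f * f) <= 1 -> f = 0.
Proof.
move=> pe sf ef ff1; have [se ee] := pe.
have fe : f * e = f by rewrite -[RHS]sf -[in RHS]ef starM sf se.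
have key r : 0 < r < 1 -> r * nrm f ^+ 2 <= 1 - r.
  move=> /andP[r0 r1]; pose x := r%:C%C *: (e + f * f).
  have [||b [sb bb bC]] := @sqrt_one_minus R A x.
  - by rewrite starZr starD se starM sf.
  - by rewrite nrmZr gtr0_norm//; have := nrm_ge0 (e + f * f); nra.
  have ex : e * x = x by rewrite -scalerAr mulrDr ee mulrA ef.
  have xe : x * e = x by rewrite -scalerAl mulrDl ee -mulrA fe.
  have eb : e * b = b * e by apply: bC; rewrite ex xe.
  have fb : f * b = b * f.
    by apply: bC; rewrite -scalerAl -scalerAr mulrDr mulrDl ef fe mulrA.
  pose g := (Num.sqrt r)%:C%C *: f.
  have sg : star g = g by rewrite starZr sf.
  have gg : g * g = r%:C%C *: (f * f).
    by rewrite -scalerAl -scalerAr scalerA -rmorphM/= -expr2 sqr_sqrtr ?ltW.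
  have sB : star (b * e) = b * e by rewrite starM sb se.
  have Bg : b * e * g = g * (b * e).
    by rewrite /g -scalerAr -scalerAl -mulrA ef (mulrA f) fb -mulrA fe.
  have yy : star (b * e + 'i%C *: g) * (b * e + 'i%C *: g) = (1 - r)%:C%C *: e.
    rewrite cartesian_sq// gg -{1}eb -mulrA (mulrA b) bb.
    rewrite mulrBl mul1r xe mulrBr ee ex /x scalerDr opprD addrA subrK.
    by rewrite rmorphB/= scalerBl scale1r.
  have := nrm_im_le sB sg; rewrite -(ler_pXn2r (n := 2))// ?nnegrE ?nrm_ge0//.
  rewrite -[leRHS]nrm_cstar yy !nrmZr exprMn real_normK ?num_real//.
  rewrite sqr_sqrtr ?(ltW r0)// ger0_norm ?subr_ge0 ?(ltW r1)//.
  move/le_trans; apply; rewrite -[leRHS]mulr1.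
  by rewrite ler_wpM2l ?subr_ge0 ?(ltW r1)//; exact: nrm_projection_le1.
apply: nrm_eq0; have := nrm_ge0 f; rewrite le_eqVlt => /predU1P[//|f0].
have n0 : 0 < nrm f ^+ 2 by rewrite exprn_gt0.
have /key : 0 < (1 + nrm f ^+ 2 / 2)^-1 < 1.
  by rewrite invr_gt0 invf_lt1; lra.
set n := nrm f ^+ 2 in n0 *.
have d0 : 0 < 1 + n / 2 by lra.
rewrite -(ler_pM2l d0) mulrA mulfV ?gt_eqF// mul1r mulrBr mulr1 mulfV ?gt_eqF//.
by lra.
Qed.

(** The average of the squares of [e + f] and [e - f] is [e + f * f]. *)
Lemma corner_extreme e f : projection e -> star f = f -> e * f = f ->
  nrm (e + f) <= 1 -> nrm (e - f) <= 1 -> f = 0.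
Proof.
move=> pe sf ef n1 n2; apply: (corner_extreme_sq pe) => //.
have [se ee] := pe.
have fe : f * e = f by rewrite -[RHS]sf -[in RHS]ef starM sf se.
have two : (e + f * f) *+ 2 = (e + f) * (e + f) + (e - f) * (e - f).
  rewrite mulrDl mulrBl !mulrDr !mulrN fe ef ee mulr2n.
  by rewrite opprB (addrC f (f * f)) (addrACA e f) (addrACA e (- f)) -opprD [RHS]addrACA subrr addr0.
rewrite -(@ler_pMn2r _ 2)// -nrmMn two.
apply: le_trans (nrmD _ _) _; rewrite mulr2n; apply: lerD.
  by apply: le_trans (nrmM _ _) _; rewrite mulr_ile1 ?nrm_ge0.
by apply: le_trans (nrmM _ _) _; rewrite mulr_ile1 ?nrm_ge0.
Qed.

(** In the corner of [e = p i] the compressions [c k = e * p k * e], [k <> i], sum to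
    zero.  Each satisfies [nrm (e - c k) <= 1], and as [c j] is minus the sum of the
    others, both [e + c j / n] and [e - c j / n] lie in the unit ball, [n] being the
    number of projections; extremality of [e] gives [c j = 0]. *)
Lemma projection_sum1_orth (I : finType) (p : I -> A) : (forall i, projection (p i)) ->
  \sum_i p i = 1 -> forall i j, i != j -> p i * p j = 0.
Proof.
move=> pp p1 i j ij; pose e := p i; have [se ee] := pp i.
pose c k := e * p k * e.
have sc k : star (c k) = c k by rewrite !starM (pp k).1 se mulrA.
have ec k : e * c k = c k by rewrite !mulrA ee.
have sumc : \sum_k c k = e by rewrite -mulr_suml -mulr_sumr p1 mulr1 ee.
have nc k : nrm (e - c k) <= 1.
  have -> : e - c k = e * (1 - p k) * e by rewrite mulrBr mulr1 mulrBl ee.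
  have q1 : nrm (1 - p k) <= 1.
    by apply/nrm_projection_le1/projectionB; rewrite ?mul1r ?mulr1//; exact: projection1.
  have e1 := nrm_projection_le1 (pp i).
  apply: le_trans (nrmM _ _) _; rewrite mulr_ile1 ?nrm_ge0//.
  by apply: le_trans (nrmM _ _) _; rewrite mulr_ile1 ?nrm_ge0.
have n_gt0 : 0 < #|I|%:R :> R by rewrite ltr0n; apply/card_gt0P; exists i.
have card_sum : #|I|%:R = \sum_(k : I) 1 :> R by rewrite sumr_const.
(* The divisor [#|I|] makes both [e + f] and [e - f] averages of contractions. *)
pose f := (#|I|%:R^-1)%:C%C *: c j.
have cj0 : c j = 0.
  have fE : c j = #|I|%:R%:C%C *: f.
    by rewrite scalerA -rmorphM/= mulfV ?gt_eqF// scale1r.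
  have eE : #|I|%:R%:C%C *: e = \sum_(k : I) e.
    by rewrite sumr_const rmorph_nat scaler_nat.
  suff : f = 0 by move=> f0; rewrite fE f0 scaler0.
  apply: (corner_extreme (pp i)); rewrite ?starZr ?sc// -/e.
  - by rewrite -scalerAr ec.
  - rewrite -(ler_pM2l n_gt0) mulr1 -{1}(gtr0_norm n_gt0) -nrmZr scalerDr -fE eE.
    have ci : c i = e by rewrite /c -/e ee.
    have -> : \sum_(k : I) e + c j =
        e + (e + \sum_(k | (k != i) && (k != j)) (e - c k)).
      rewrite sumrB (bigD1 i)//= (bigD1 j) 1?eq_sym//= -!addrA; do 3!congr (_ + _).
      have /eqP := sumc; rewrite (bigD1 i)//= ci (bigD1 j) 1?eq_sym//=.
      by rewrite eq_sym -subr_eq0 addrAC subrr add0r addr_eq0 => /eqP.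
    rewrite card_sum [leRHS](bigD1 i)//= [X in _ <= _ + X](bigD1 j) 1?eq_sym//=.
    apply: le_trans (nrmD _ _) _; apply: lerD; first exact: nrm_projection_le1.
    apply: le_trans (nrmD _ _) _; apply: lerD; first exact: nrm_projection_le1.
    exact: le_trans (nrm_sum _ _ _) (ler_sum _ _).
  - rewrite -(ler_pM2l n_gt0) mulr1 -{1}(gtr0_norm n_gt0) -nrmZr scalerBr -fE eE.
    rewrite card_sum (bigD1 j)//= [leRHS](bigD1 j)//= addrAC.
    apply: le_trans (nrmD _ _) _; apply: lerD => //.
    apply: le_trans (nrm_sum _ _ _) (ler_sum _ _) => k _.
    exact: nrm_projection_le1.
have sq : star (p j * p i) * (p j * p i) = 0.
  by rewrite starM se (pp j).1 -mulrA (mulrA (p j)) (pp j).2 mulrA.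
have ji0 : p j * p i = 0.
  by apply: nrm_eq0; apply/eqP; rewrite -sqrf_eq0 -nrm_cstar sq nrm0.
by rewrite -[p i]se -(pp j).1 -starM ji0 star0.
Qed.

End Cartesian.

Section Contractive.
Context {R : realType} {A B : cstarAlgType R}.

(** A self-adjoint [a] with [nrm a < 1] is the real part of the unitary
    [a + i b], [b * b = 1 - a * a]; a star-homomorphism preserves unitaries, and
    these have norm 1. *)
Lemma starhom_contractive (f : {lrmorphism A -> B}) : star_preserving f ->
  forall x, nrm (f x) <= nrm x.
Proof.
move=> fs.
have unit_ball a : star a = a -> nrm a < 1 -> nrm (f a) <= 1.
  move=> sa a1.
  have [||b [sb bb bC]] := @sqrt_one_minus R A (a * a).
  - by rewrite starM sa.
  - by apply: le_lt_trans (nrmM _ _) _; have := nrm_ge0 a; nra.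
  have sfa : star (f a) = f a by rewrite -fs sa.
  have sfb : star (f b) = f b by rewrite -fs sb.
  apply: le_trans (nrm_re_le sfa sfb) _.
  rewrite -(@ler_pXn2r _ 2)// ?nnegrE ?nrm_ge0 ?ler01// -nrm_cstar.
  rewrite cartesian_sq// -!rmorphM ?bC ?mulrA//=.
  by rewrite -rmorphD/= bb addrC subrK rmorph1 nrm1 expr1n.
have sa_le a : star a = a -> nrm (f a) <= nrm a.
  move=> sa; apply/ler_addgt0Pl => e e0.
  have d0 : 0 < e + nrm a by rewrite ltr_pwDl ?nrm_ge0.
  have := @unit_ball ((e + nrm a)^-1%:C%C *: a).
  rewrite starZr sa linearZ/= !nrmZr gtr0_norm ?invr_gt0//.
  rewrite mulrC ltr_pdivrMr// mul1r ltrDr e0 => /(_ erefl isT).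
  by rewrite mulrC ler_pdivrMr// mul1r.
move=> x; rewrite -(@ler_pXn2r _ 2)// ?nnegrE ?nrm_ge0// -!nrm_cstar -fs -rmorphM.
by apply: sa_le; rewrite starM starK.
Qed.

End Contractive.

(** * Words in a Cuntz-Krieger family *)

Definition arrow {N : nat} (M : 'M[nat]_N) (i j : 'I_N) := M i j == 1%N.

Section Words.
Context {R : realType} {N : nat} {M : 'M[nat]_N} {C : cstarAlgType R}.
Variable S : 'I_N -> C.

Definition monom (w : seq 'I_N) : C := \prod_(i <- w) S i.

Definition cylproj w : C := monom w * star (monom w).

Lemma monom_nil : monom [::] = 1. Proof. exact: big_nil. Qed.

Lemma monom_cons i w : monom (i :: w) = S i * monom w.
Proof. exact: big_cons. Qed.

Lemma monom_cat v w : monom (v ++ w) = monom v * monom w.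
Proof. exact: big_cat. Qed.

Lemma monom_seq1 i : monom [:: i] = S i.
Proof. by rewrite monom_cons monom_nil mulr1. Qed.

Lemma monom_rcons w i : monom (rcons w i) = monom w * S i.
Proof. by rewrite -cats1 monom_cat monom_seq1. Qed.

Lemma star_cylproj w : star (cylproj w) = cylproj w.
Proof. by rewrite starM starK. Qed.

Hypothesis M01 : zero_one_mx M.
Hypothesis CKS : CK_family M S.

Let pS i : S i * star (S i) * S i = S i. Proof. by have [] := CKS. Qed.
Let sumS : \sum_j S j * star (S j) = 1. Proof. by have [] := CKS. Qed.
Let rS i : star (S i) * S i = \sum_j (S j * star (S j)) *+ M i j.
Proof. by have [] := CKS. Qed.

Local Notation arrow := (arrow M).

Lemma arrowN i j : ~~ arrow i j -> M i j = 0%N.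
Proof. by rewrite /arrow; have := M01 i j; rewrite !inE => /orP[/eqP->|->]. Qed.

Let pS' i : star (S i) * S i * star (S i) = star (S i).
Proof. by rewrite -{4}[S i]pS !starM starK mulrA. Qed.

Lemma gen_proj i : projection (S i * star (S i)).
Proof. by split; rewrite ?starM ?starK// mulrA pS. Qed.

(** The Cuntz-Krieger relations do not assert that the ranges are orthogonal: it
    follows from their being projections with sum 1. *)
Lemma gen_orth i j : i != j -> star (S i) * S j = 0.
Proof.
move=> ij; have o : S i * star (S i) * (S j * star (S j)) = 0.
  exact: projection_sum1_orth gen_proj sumS _ _ ij.
have -> : star (S i) * S j = star (S i) * (S i * star (S i) * (S j * star (S j))) * S j.
  by rewrite !mulrA pS' -!mulrA (mulrA (S j)) pS.
by rewrite o mulr0 mul0r.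
Qed.

Lemma source_gen i j : star (S i) * S i * S j = S j *+ M i j.
Proof.
rewrite rS mulr_suml (bigD1 j)//= mulrnAl pS big1 ?addr0// => k kj.
by rewrite mulrnAl -mulrA gen_orth// mulr0 mul0rn.
Qed.

Lemma gen_mul0 i j : ~~ arrow i j -> S i * S j = 0.
Proof.
by move=> /arrowN ij; rewrite -(pS i) -mulrA -mulrA (mulrA (star _))
  source_gen ij mulr0.
Qed.

Lemma monom_not_sorted w : ~~ sorted arrow w -> monom w = 0.
Proof.
case: w => //= i w; elim: w i => //= j w IH i; rewrite negb_and => /orP[|/IH].
  by move=> /gen_mul0 ij; rewrite !monom_cons mulrA ij mul0r.
by move=> w0; rewrite monom_cons w0 mulr0.
Qed.

Lemma source_monom i w : path arrow i w ->
  star (monom (i :: w)) * monom (i :: w) = star (S (last i w)) * S (last i w).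
Proof.
elim: w i => [|j w IH] i /=; first by rewrite monom_seq1.
case/andP=> /eqP ij /IH <-; rewrite monom_cons starM -mulrA (mulrA _ (S i)).
by rewrite [in X in _ * X]monom_cons (mulrA _ (S j)) source_gen ij -monom_cons.
Qed.

Lemma monom_partial_isometry w : monom w * star (monom w) * monom w = monom w.
Proof.
case: w => [|i w]; first by rewrite monom_nil star1 !mulr1.
have [iw|/monom_not_sorted ->] := boolP (sorted arrow (i :: w)); last first.
  by rewrite mulr0.
rewrite -mulrA source_monom//.
by rewrite lastI monom_rcons -!mulrA (mulrA (S _)) pS.
Qed.

(** The source projection of [monom u] depends only on the last letter of [u], and a
    word ending with the same letter absorbs it: the products
    [monom v * star (monom u)] behave like matrix units. *)
Lemma monom_source_last v u : v != [::] -> sorted arrow u -> u != [::] ->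
  (forall i, last i v = last i u) -> monom v * (star (monom u) * monom u) = monom v.
Proof.
case: u => // i u; case/lastP: v => // v j _ iu _ /(_ i).
by rewrite last_rcons /= source_monom// => <-; rewrite monom_rcons -!mulrA (mulrA (S j)) pS.
Qed.

Lemma monom_orth v w : size v = size w -> v != w -> star (monom v) * monom w = 0.
Proof.
elim: v w => [|i v IH] [|j w]//= [sz]; rewrite eqseq_cons !monom_cons starM.
rewrite -mulrA (mulrA (star (S i))).
have [<-{j}/= vw|ij _] := eqVneq i j; last by rewrite gen_orth// mul0r mulr0.
case: w sz vw => [|k w] sz vw; first by case: v sz vw {IH}.
rewrite monom_cons (mulrA _ (S k)) source_gen mulrnAl mulrnAr -monom_cons.
by rewrite IH// mul0rn.
Qed.

Lemma cylproj_proj w : projection (cylproj w).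
Proof.
by split; [exact: star_cylproj|rewrite /cylproj mulrA monom_partial_isometry].
Qed.

Lemma cylprojM v w : (size v <= size w)%N ->
  cylproj v * cylproj w = if take (size v) w == v then cylproj w else 0.
Proof.
rewrite -{2 3 4}(cat_take_drop (size v) w) => vw.
have : size (take (size v) w) = size v by rewrite size_takel.
move: (take _ w) (drop _ w) => t d tv {vw w}; rewrite take_size_cat//.
rewrite /cylproj monom_cat; have [->|tv'] := eqVneq t v.
  by rewrite !mulrA monom_partial_isometry.
rewrite -mulrA -(mulrA (monom t)) (mulrA (star (monom v))) monom_orth 1?eq_sym//.
by rewrite mul0r mulr0.
Qed.

Lemma cylproj_rcons w : cylproj w = \sum_j cylproj (rcons w j).
Proof.
rewrite /cylproj; under eq_bigr do rewrite monom_rcons starM mulrA -(mulrA _ (S _)).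
by rewrite -mulr_suml -mulr_sumr sumS mulr1.
Qed.

Hypothesis irrM : irreducible_mx M.

Lemma irreducible_arrow i : exists j, arrow i j.
Proof.
have [[//|n] _] := irrM i i; rewrite exprS mxE => pos.
have [/existsP//|] := boolP [exists j, arrow i j].
rewrite negb_exists => /forallP no; move: pos; rewrite big1 ?ltxx// => k _.
by rewrite arrowN ?mul0r.
Qed.

(** Some generator is nonzero because the ranges sum to 1, and [S i = 0] forces
    [S k = 0] for every arrow from [i] to [k]. *)
Lemma gen_neq0 i : S i != 0.
Proof.
have [j Sj] : exists j, S j != 0.
  have [/existsP//|] := boolP [exists j, S j != 0].
  rewrite negb_exists => /forallP no; have /eqP := sumS.
  by rewrite big1 => [|k _]; rewrite 1?eq_sym ?oner_eq0// (eqP (negbNE (no k))) mul0r.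
have [n _] := irrM i j; elim: n i => [|n IH] i.
  rewrite expr0 mxE; have [->//|_] := eqVneq i j; by [].
rewrite exprS mxE => pos.
have [k ik kj] : exists2 k, arrow i k & (0 < (M ^+ n) k j)%N.
  have [/existsP[k /andP[]]|] := boolP [exists k, arrow i k && (0 < (M ^+ n) k j)%N].
    by exists k.
  rewrite negb_exists => /forallP no; move: pos; rewrite big1 ?ltxx// => k _.
  have := no k; rewrite negb_and -leqNgt leqn0 => /orP[/arrowN->|/eqP->].
    by rewrite mul0r.
  by rewrite mulr0.
apply: contra (IH k kj) => /eqP Si; have := source_gen i k.
by rewrite (eqP ik) Si mulr0 mul0r mulr1n => <-.
Qed.

Lemma star_mul_eq0 (x : C) : star x * x = 0 -> x = 0.
Proof.
move=> xx; apply: nrm_eq0; apply/eqP; rewrite -sqrf_eq0 -nrm_cstar.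
by rewrite xx nrm0.
Qed.

Lemma monom_neq0 w : sorted arrow w -> monom w != 0.
Proof.
case: w => [|i w]; first by rewrite monom_nil oner_neq0.
move=> iw; apply: contra_neq (gen_neq0 (last i w)) => m0.
by apply: star_mul_eq0; rewrite -source_monom// m0 mulr0.
Qed.

Lemma cylproj_neq0 w : sorted arrow w -> cylproj w != 0.
Proof.
move/monom_neq0; apply: contra_neq; rewrite /cylproj -{1}[monom w]starK.
by move=> /star_mul_eq0 /(congr1 star); rewrite starK star0.
Qed.

Lemma cylproj_sorted w : cylproj w != 0 -> sorted arrow w.
Proof. by apply: contraTT => /monom_not_sorted m0; rewrite /cylproj m0 mul0r eqxx. Qed.

End Words.

(** * Points and cylinders of the shift space *)

Section Points.
Context {N : nat} {M : 'M[nat]_N}.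
Local Notation X := (shift_space M).
Implicit Types x y z : X.

Definition letter x n : 'I_N := (set_val x : nat -> 'I_N) n.

Lemma shift_space_eq x y : (forall n, letter x n = letter y n) -> x = y.
Proof. by move=> xy; apply: val_inj; apply/funext => n; exact: xy. Qed.

Lemma letter_iter_shift k x n : letter (iter k (@Defs.shift _ M) x) n = letter x (k + n).
Proof. by elim: k n => //= k IH n; rewrite addSnnS -IH. Qed.

Lemma letter_admissible x n : M (letter x n) (letter x n.+1) = 1%N.
Proof. by have /set_mem := valP x; apply. Qed.

Definition point (s : nat -> 'I_N) (Ms : forall n, M (s n) (s n.+1) = 1%N) : X :=
  SigSub (mem_set (Ms : admissible M s)).

Lemma letter_point s Ms n : letter (@point s Ms) n = s n.
Proof. by []. Qed.

Definition agree n x y := forall k, (k < n)%N -> letter x k = letter y k.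

Lemma agree_sym n x y : agree n x y -> agree n y x.
Proof. by move=> xy k /xy. Qed.

Lemma agree_trans n x y z : agree n x y -> agree n y z -> agree n x z.
Proof. by move=> xy yz k kn; rewrite xy ?yz. Qed.

Lemma agreeW m n x y : (m <= n)%N -> agree n x y -> agree m x y.
Proof. by move=> mn xy k km; apply: xy; exact: leq_trans mn. Qed.

Lemma agree_eq x y : (forall n, agree n x y) -> x = y.
Proof. by move=> xy; apply: shift_space_eq => n; exact: (xy n.+1). Qed.

Lemma cylinder_nbhs x n : nbhs x (agree n x).
Proof.
have coord k : nbhs x [set y | letter y k = letter x k].
  have ck : continuous (fun y : X => proj k (set_val y)).
    move=> y; apply: continuous_comp; first exact: initial_continuous.
    exact: proj_continuous.
  apply: (ck x [set a | a = letter x k]).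
  by rewrite nbhs_principalE; exact/principal_filterP.
elim: n => [|n IH]; first by apply: filterS filterT.
apply: filterS (filterI IH (coord n)) => y [xy yn] k.
by rewrite ltnS leq_eqVlt => /predU1P[->//|]; exact: xy.
Qed.

(** The filter generated by the cylinders around [x] converges to [x] coordinatewise,
    hence in the product topology. *)
Lemma nbhs_cylinder x (U : set X) : nbhs x U ->
  exists n, forall y, agree n x y -> U y.
Proof.
pose F : set_system {ptws nat -> discrete_topology 'I_N} :=
  filter_from setT (fun n => [set s | forall k, (k < n)%N -> letter x k = s k]).
have FF : Filter F.
  apply: filter_from_filter; first by exists 0%N.
  move=> m n _ _; exists (maxn m n) => // s sP.
  by split=> k kn; apply: sP; rewrite leq_max kn ?orbT.
have Fx : F --> (set_val x : {ptws nat -> discrete_topology 'I_N}).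
  apply/pointwise_cvgP => k V; rewrite nbhs_principalE => /principal_filterP Vk.
  by exists k.+1 => // s sx /=; rewrite -sx.
case=> _ [[V oV <-] Vx VU].
have [n _ nV] : F V by apply: Fx; apply: open_nbhs_nbhs.
by exists n => y xy; apply: VU; apply: nV.
Qed.

Definition word x n : seq 'I_N := mkseq (letter x) n.

Lemma size_word x n : size (word x n) = n. Proof. exact: size_mkseq. Qed.

Lemma word_agree n x y : agree n x y <-> word x n = word y n.
Proof.
split=> [xy|xy k kn]; first by apply/eq_in_map => k; rewrite mem_iota; exact: xy.
by rewrite -(nth_mkseq (letter x 0) (letter x) kn) -/(word x n) xy nth_mkseq.
Qed.

Lemma word_rcons x n : word x n.+1 = rcons (word x n) (letter x n).
Proof. by rewrite /word mkseqS. Qed.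

Lemma word_cons x n : word x n.+1 = letter x 0 :: word (Defs.shift x) n.
Proof. by rewrite /word /mkseq -add1n iotaD map_cat (iotaDl 1 0) -map_comp. Qed.

Lemma sorted_word x n : sorted (arrow M) (word x n).
Proof.
case: n => // n; apply/(sortedP (letter x 0)) => k; rewrite size_word => kn.
by rewrite !nth_mkseq// ?(ltnW kn)// /arrow letter_admissible.
Qed.

Lemma take_word x m n : (m <= n)%N -> take m (word x n) = word x m.
Proof. by move=> mn; rewrite /word /mkseq -map_take take_iota (minn_idPl mn). Qed.

(** Compactness of the shift space, as a statement about eventually true
    properties: a point all of whose cylinders are bad would arise from the tree
    of bad words. *)
Lemma shift_space_uniform (P : X -> nat -> Prop) :
  (forall x m n, (m <= n)%N -> P x m -> P x n) ->
  (forall x, exists m n, forall y, agree m x y -> P y n) ->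
  exists n, forall x, P x n.
Proof.
move=> Pmono Ploc; apply: contrapT => noP.
pose bad (w : seq 'I_N) := forall n, exists2 x, word x (size w) = w & ~ P x n.
have bad0 : bad [::].
  by move=> n; apply: contrapT => ok; apply: noP; exists n => x;
    apply: contrapT => nP; apply: ok; exists x.
have [x0 _ _] := bad0 0%N.
have badS w : exists j, bad w -> bad (rcons w j).
  apply: contrapT => /forallNP no; have bw : bad w.
    by apply: contrapT => nb; apply: (no (letter x0 0)) => /nb.
  have /choice[g gP] : forall j, exists n, forall x, word x (size w).+1 = rcons w j -> P x n.
    move=> j; apply: contrapT => /forallNP nj; apply: (no j) => _ n.
    apply: contrapT => ok; apply: (nj n) => x xw; apply: contrapT => nP.
    by apply: ok; exists x; rewrite ?size_rcons.
  have [x xw] := bw (\max_j g j)%N; apply.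
  apply: (Pmono _ _ _ (leq_bigmax (letter x (size w)))).
  by apply: gP; rewrite word_rcons xw.
have [f fP] := choice badS.
pose W k := iter k (fun w => rcons w (f w)) [::]; pose s k := f (W k).
have badW k : bad (W k) by elim: k => //= k; exact: fP.
have WE k : W k = mkseq s k by elim: k => // k IH; rewrite mkseqS -IH.
have sW k : size (W k) = k by rewrite WE size_mkseq.
have Ms k : M (s k) (s k.+1) = 1%N.
  have [x] := badW k.+2 0%N; rewrite sW WE => xs _.
  have sE l : (l < k.+2)%N -> s l = letter x l.
    by move=> lk; rewrite -(nth_mkseq (s 0) s lk) -xs nth_mkseq.
  by rewrite !sE ?letter_admissible.
have [m [n mn]] := Ploc (point Ms).
have [x] := badW m n; rewrite sW WE => xs; apply; apply: mn.
exact/word_agree.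
Qed.

Lemma splice x n y : letter x n = letter y 0 ->
  exists2 z, agree n.+1 x z & iter n (@Defs.shift _ M) z = y.
Proof.
move=> xy; pose s k := if (k < n)%N then letter x k else letter y (k - n).
have Ms k : M (s k) (s k.+1) = 1%N.
  rewrite /s; have [kn|kn|kn] := ltngtP k.+1 n.
  - exact: letter_admissible.
  - by rewrite subSn// letter_admissible.
  - by rewrite -kn subnn -xy -kn letter_admissible.
exists (point Ms) => [k|].
  rewrite ltnS letter_point /s; case: ltngtP => // -> _.
  by rewrite subnn.
apply: shift_space_eq => k; rewrite letter_iter_shift letter_point /s.
by rewrite ltnNge leq_addr/= addKn.
Qed.

Lemma agree_iter_eq n x y : agree n x y ->
  iter n (@Defs.shift _ M) x = iter n (@Defs.shift _ M) y -> x = y.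
Proof.
move=> xy sxy; apply: shift_space_eq => k.
have [/xy//|nk] := ltnP k n.
by rewrite -(subnKC nk) -!letter_iter_shift sxy.
Qed.

Hypothesis ext : forall i, exists j, arrow M i j.

Lemma point_from i : exists x, letter x 0 = i.
Proof.
have [g gP] := choice ext.
have Ms k : M (iter k g i) (iter k.+1 g i) = 1%N by apply/eqP; exact: gP.
by exists (point Ms).
Qed.

Lemma point_from2 i j : arrow M i j -> exists2 x, letter x 0 = i & letter x 1 = j.
Proof.
move=> ij; have [x xj] := point_from j.
pose s k := if k is l.+1 then letter x l else i.
have Ms k : M (s k) (s k.+1) = 1%N.
  by case: k => [|k] /=; rewrite ?xj ?letter_admissible//; exact/eqP.
by exists (point Ms).
Qed.

End Points.

Section Continuity.
Context {N N' : nat} {M : 'M[nat]_N} {M' : 'M[nat]_N'}.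

Lemma continuous_agree (h : shift_space M -> shift_space M') : continuous h <->
  forall x n, exists m, forall y, agree m x y -> agree n (h x) (h y).
Proof.
split=> [ch x n|ch x U /nbhs_cylinder[n nU]].
  by apply: nbhs_cylinder; apply: ch; exact: cylinder_nbhs.
have [m mn] := ch x n.
by apply: filterS (cylinder_nbhs x m) => y /mn; exact: nU.
Qed.

Lemma continuous_nat_agree (k : shift_space M -> nat) : continuous k ->
  forall x, exists m, forall y, agree m x y -> k y = k x.
Proof.
move=> ck x; apply: nbhs_cylinder; apply: (ck x [set n | n = k x]).
by rewrite nbhs_principalE; exact/principal_filterP.
Qed.

End Continuity.

(** * Relations between points with a common tail *)

Section Words.
Context {N : nat}.

(** Words of a given length are listed by appending letters, so that refining a sum
    by one more letter is unfolding the recursion. *)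
Fixpoint words n : seq (seq 'I_N) :=
  if n is m.+1 then [seq rcons w j | w <- words m, j <- enum 'I_N] else [:: [::]].
Arguments words : simpl never.

Lemma mem_words n w : (w \in words n) = (size w == n).
Proof.
elim: n w => [|n IH] w; first by rewrite inE; case: w.
apply/allpairsP/eqP => [[[v j] /= [+ _ ->]]|].
  by rewrite IH size_rcons => /eqP->.
case/lastP: w => // w j; rewrite size_rcons => -[sw].
by exists (w, j); rewrite /= IH sw mem_enum.
Qed.

Lemma uniq_words n : uniq (words n).
Proof.
elim: n => // n IH; apply: allpairs_uniq => //; first exact: enum_uniq.
by move=> [v j] [w k] _ _ /= /rcons_inj[-> ->].
Qed.

Lemma big_words_rcons (V : nmodType) n (F : seq 'I_N -> V) :
  \sum_(w <- words n.+1) F w = \sum_(w <- words n) \sum_j F (rcons w j).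
Proof.
rewrite big_allpairs_dep; apply: eq_bigr => w _.
by rewrite big_enum.
Qed.

End Words.
Arguments words : simpl never.

Section Relations.
Context {N : nat} {M : 'M[nat]_N}.
Local Notation X := (shift_space M).
Local Notation sft := (@Defs.shift _ M).
Implicit Types (x y z : X) (E F : X -> X -> Prop) (v u w : seq 'I_N).

(** A relation of level [(a, b)] is a finite union of sets of pairs [(v z, u z)],
    where [v] and [u] are words of lengths [a.+1] and [b.+1] with the same last
    letter and [z] is any common tail; in other words, a compact open set in degree
    [a - b] of the groupoid of the shift. *)
Definition level a b E :=
  (forall x y, E x y -> iter a sft x = iter b sft y) /\
  (forall x y x' y', E x y -> agree a.+1 x x' -> agree b.+1 y y' ->
    iter a sft x' = iter b sft y' -> E x' y').

(** For [E] of level [(a, b)] and words of lengths [a.+1], [b.+1], this says that [E]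
    contains all pairs [(v z, u z)], see [meetsP]. *)
Definition meets E v u :=
  `[< exists x y, [/\ E x y, word x (size v) = v & word y (size u) = u] >].

Definition inverse E x y := E y x.
Definition comp E F x z := exists2 y, E x y & F y z.
Definition functional E := forall x y z, E x y -> E x z -> y = z.

Lemma relation_ext E F : (forall x y, E x y <-> F x y) -> E = F.
Proof. by move=> EF; apply/funext => x; apply/funext => y; exact/propext. Qed.

Lemma level_inverse a b E : level a b E -> level b a (inverse E).
Proof.
by case=> g1 g2; split=> [x y /g1//|x y x' y' xy xx yy s]; apply: (g2 _ _ _ _ xy).
Qed.

Lemma last_word x n i : last i (word x n.+1) = letter x n.
Proof. by rewrite word_rcons last_rcons. Qed.

Lemma level_letter a b E x y : level a b E -> E x y -> letter x a = letter y b.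
Proof.
by case=> g1 _ /g1 xy; rewrite -[a]addn0 -letter_iter_shift xy letter_iter_shift addn0.
Qed.

(** The letters in position [a] and [b] of related points agree, so that nothing is
    lost by requiring a common tail only from the next position on. *)
Lemma levelS a b E : level a b E -> level a.+1 b.+1 E.
Proof.
move=> gE; have [g1 g2] := gE; split=> [x y /g1 /= ->//|x y x' y' xy xx yy s].
apply: (g2 _ _ _ _ xy); [exact: agreeW xx|exact: agreeW yy|].
apply: (@agree_iter_eq _ _ 1) => // k.
rewrite ltnS leqn0 => /eqP->; rewrite !letter_iter_shift !addn0.
by rewrite -xx// -yy// (level_letter gE xy).
Qed.

Lemma level_comp a b c E F : level a b E -> level b c F -> level a c (comp E F).
Proof.
move=> gE gF; have [[E1 E2] [F1 F2]] := (gE, gF).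
split=> [x z [y /E1 -> /F1//]|x z x' z' [y xy yz] xx zz s].
have [|y' yy' y's] := @splice _ _ y b (iter a sft x').
  by rewrite letter_iter_shift addn0 -xx// (level_letter gE xy).
by exists y'; [exact: E2 xy _ _ _|apply: F2 yz _ _ _ => //; rewrite y's].
Qed.

Lemma level_or a b E F : level a b E -> level a b F ->
  level a b (fun x y => E x y \/ F x y).
Proof.
move=> [E1 E2] [F1 F2]; split=> [x y [/E1|/F1]//|x y x' y' [xy|xy] xx yy s].
  by left; exact: E2 xy _ _ _.
by right; exact: F2 xy _ _ _.
Qed.

Lemma meetsP a b E v u x y : level a b E -> size v = a.+1 -> size u = b.+1 ->
    meets E v u -> word x a.+1 = v -> word y b.+1 = u ->
  iter a sft x = iter b sft y -> E x y.
Proof.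
move=> [_ g2] sv su /asboolP[x' [y' [xy]]]; rewrite sv su => x'v y'u xv yu s.
by apply: (g2 _ _ _ _ xy) => //; apply/word_agree; rewrite ?xv ?yu.
Qed.

Lemma meets_inverse E v u : meets (inverse E) u v = meets E v u.
Proof.
by apply/asboolP/asboolP => -[x [y [? ? ?]]]; exists y, x; split.
Qed.

Lemma meets_sorted E v u : meets E v u -> sorted (arrow M) v && sorted (arrow M) u.
Proof. by move=> /asboolP[x [y [_ <- <-]]]; rewrite !sorted_word. Qed.

Lemma meets_last a b E v u : level a b E -> size v = a.+1 -> size u = b.+1 ->
  meets E v u -> forall i, last i v = last i u.
Proof.
move=> gE sv su /asboolP[x [y [xy <- <-]]] i.
by rewrite sv su !last_word (level_letter gE xy).
Qed.

Lemma meets_rcons a b E v u j k : level a b E -> size v = a.+1 -> size u = b.+1 ->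
  meets E (rcons v j) (rcons u k) -> meets E v u /\ j = k.
Proof.
move=> gE sv su /asboolP[x [y [xy]]]; rewrite !size_rcons !word_rcons.
move=> /rcons_inj[xv xj] /rcons_inj[yu yk]; split; first by apply/asboolP; exists x, y.
by have := level_letter (levelS gE) xy; rewrite -sv -su xj yk.
Qed.

Hypothesis ext : forall i, exists j, arrow M i j.

Lemma meets_extend a b E v u i j : level a b E -> size v = a.+1 -> size u = b.+1 ->
  meets E v u -> arrow M (last i v) j -> meets E (rcons v j) (rcons u j).
Proof.
move=> gE sv su /asboolP[x [y [xy]]]; rewrite sv su => xv yu.
rewrite -{1}xv last_word => /(point_from2 ext)[z zi zj].
have [x' xx' x's] := splice (esym zi).
have [|y' yy' y's] := @splice _ _ y b z; first by rewrite zi (level_letter gE xy).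
apply/asboolP; exists x', y'; rewrite !size_rcons sv su (word_rcons x') (word_rcons y').
have -> : word x' a.+1 = v by rewrite -xv; apply/esym/word_agree.
have -> : word y' b.+1 = u by rewrite -yu; apply/esym/word_agree.
split; first by apply: gE.2 xy _ _ _ => //; rewrite x's.
  by congr rcons; rewrite -zj -x's letter_iter_shift addn1.
by congr rcons; rewrite -zj -y's letter_iter_shift addn1.
Qed.

Lemma level_eq : level 0 0 (fun x y => x = y).
Proof. by split=> // x y x' y'. Qed.

(** The graph of the inverse branches of the shift: [branch i] is the relation that
    the generator [S i] implements. *)
Definition branch i x y := letter x 0 = i /\ sft x = y.

Lemma level_branch i : level 1 0 (branch i).
Proof. by split=> [x y []//|x y x' y' [<- xy] xx yy s]; split; rewrite // -xx. Qed.

End Relations.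

(** * Elements attached to relations *)

Section Operators.
Context {R : realType} {N : nat} {M : 'M[nat]_N} {C : cstarAlgType R}.
Variable S : 'I_N -> C.
Hypothesis M01 : zero_one_mx M.
Hypothesis CKS : CK_family M S.
Hypothesis ext : forall i, exists j, arrow M i j.
Local Notation X := (shift_space M).
Local Notation sft := (@Defs.shift _ M).
Implicit Types (x y z : X) (E F : X -> X -> Prop) (v u w : seq 'I_N).

(** The element given by the characteristic function of [E], which is a sum of
    matrix units. *)
Definition relop a b E : C :=
  \sum_(v <- words a.+1) \sum_(u <- words b.+1)
     (monom S v * star (monom S u)) *+ meets E v u.

Lemma eq_big_words n (F G : seq 'I_N -> C) :
  (forall w, size w = n -> F w = G w) ->
  \sum_(w <- words n) F w = \sum_(w <- words n) G w.
Proof.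
by move=> FG; apply: eq_big_seq => w; rewrite mem_words => /eqP; exact: FG.
Qed.

Lemma big_words_only n u (F : seq 'I_N -> C) : size u = n ->
    (forall w, size w = n -> w != u -> F w = 0) ->
  \sum_(w <- words n) F w = F u.
Proof.
move=> su F0; rewrite (bigD1_seq u) ?uniq_words ?mem_words ?su//= big_seq_cond.
by rewrite big1 ?addr0// => w; rewrite mem_words => /andP[/eqP]; exact: F0.
Qed.

(** As [1] is the sum of the range projections, [monom v * star (monom u)] is the sum
    over [j] of the same expression for [rcons v j] and [rcons u j], and the terms
    for which [j] cannot follow [v] vanish. *)
Lemma relopS a b E : level a b E -> relop a.+1 b.+1 E = relop a b E.
Proof.
move=> gE; rewrite /relop big_words_rcons; apply: eq_big_words => v sv.
under eq_bigr do rewrite big_words_rcons.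
rewrite exchange_big /=; apply: eq_big_words => u su.
have [vu|vu] := boolP (meets E v u); last first.
  rewrite big1 // => j _; rewrite big1 // => k _.
  have [/(meets_rcons gE sv su)[vu' _]|//] := boolP (meets E (rcons v j) (rcons u k)).
  by rewrite vu' in vu.
rewrite mulr1n -[monom S v]mulr1; have [_ <- _] := CKS.
rewrite mulr_sumr mulr_suml; apply: eq_bigr => j _.
rewrite (bigD1 j)//= [X in _ + X]big1 ?addr0 => [|k kj]; last first.
  have [/(meets_rcons gE sv su)[_ jk]|//] := boolP (meets E (rcons v j) (rcons u k)).
  by rewrite jk eqxx in kj.
rewrite !monom_rcons starM !mulrA -(mulrA (monom S v)).
have [vj|] := boolP (meets E (rcons v j) (rcons u j)); first by rewrite mulr1n mulrA.
case: v sv vu => // i v sv vu; have [vj|vj _] := boolP (arrow M (last i v) j).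
  by rewrite (meets_extend ext gE sv su (i := i) vu).
rewrite mulr0n lastI monom_rcons.
rewrite mulrA -(mulrA _ (S _) (S j)).
by rewrite (gen_mul0 M01 CKS vj) mulr0 !mul0r.
Qed.

Lemma relop_inverse a b E : relop b a (inverse E) = star (relop a b E).
Proof.
rewrite /relop star_sum exchange_big /=; apply: eq_bigr => v _.
rewrite star_sum; apply: eq_bigr => u _.
by rewrite starMn starM starK meets_inverse.
Qed.

(** A product of matrix units vanishes unless the middle words agree; as [E] is
    functional, at most one middle word links two given words. *)
Lemma relop_mul a b c E F : level a b E -> level b c F -> functional E ->
  relop a b E * relop b c F = relop a c (comp E F).
Proof.
move=> gE gF fE; rewrite /relop mulr_suml; apply: eq_big_words => v sv.
rewrite mulr_suml.
transitivity (\sum_(u <- words b.+1) \sum_(w <- words c.+1)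
    (monom S v * star (monom S w)) *+ (meets E v u && meets F u w)).
  apply: eq_big_words => u su; rewrite mulr_sumr (big_words_only su) => [|u' su' uu'].
    rewrite mulr_sumr; apply: eq_big_words => w sw.
    have [vu|_] := boolP (meets E v u); last by rewrite mul0r.
    rewrite mulr1n mulrnAr mulrA -(mulrA (monom S v)) (monom_source_last CKS)//.
    - by rewrite -size_eq0 sv.
    - by have /andP[] := meets_sorted vu.
    - by rewrite -size_eq0 su.
    - exact: meets_last gE sv su vu.
  rewrite mulr_sumr big1// => w _.
  rewrite mulrnAl mulrnAr -mulrA (mulrA (star _)) (monom_orth CKS) ?su//.
    by rewrite mul0r mulr0 !mul0rn.
  by rewrite eq_sym.
rewrite exchange_big /=; apply: eq_big_words => w sw.
have [/asboolP[x [z [[y xy yz] xv zw]]]|vw] := boolP (meets (comp E F) v w).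
  have yb : size (word y b.+1) = b.+1 := size_word y b.+1.
  have mE : meets E v (word y b.+1).
    by apply/asboolP; exists x, y; rewrite yb.
  have mF : meets F (word y b.+1) w.
    by apply/asboolP; exists y, z; rewrite yb.
  rewrite (big_words_only yb) ?mE ?mF// => u su /negP uy.
  have [/asboolP[x' [y' [x'y' x'v y'u]]]|//] := boolP (meets E v u).
  case: uy; apply/eqP.
  have xx' : agree a.+1 x' x by apply/word_agree; rewrite -sv x'v.
  have [|y'' yy'' y's] := @splice _ _ y' b (iter a sft x).
    by rewrite letter_iter_shift addn0 -xx'// (level_letter gE x'y').
  have xy'' : E x y'' by apply: gE.2 x'y' _ _ _.
  rewrite (fE _ _ _ xy xy'') -y'u su; apply/word_agree.
  exact: yy''.
rewrite big_seq big1// => u; rewrite mem_words => /eqP su.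
have [/andP[vu uw]|//] := boolP (meets E v u && meets F u w).
case/negP: vw; move: uw => /asboolP[y [z [yz yu zw]]].
move/asboolP: vu => [x [y' [xy' xv y'u]]]; apply/asboolP.
have [|z' zz' z's] := @splice _ _ z c (iter b sft y').
  rewrite letter_iter_shift addn0 -(level_letter gF yz).
  by apply/esym; have /word_agree := etrans y'u (esym yu); rewrite su; apply.
exists x, z'; split=> //.
  exists y' => //; apply: gF.2 yz _ _ _ => //; apply/word_agree.
  by rewrite -su y'u.
by rewrite -zw sw size_word; apply/esym/word_agree.
Qed.

Lemma relop_or a b E F : level a b E -> level a b F ->
  (forall x y, E x y -> F x y -> False) ->
  relop a b (fun x y => E x y \/ F x y) = relop a b E + relop a b F.
Proof.
move=> gE gF EF; rewrite /relop -big_split /=; apply: eq_big_words => v sv.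
rewrite -big_split /=; apply: eq_big_words => u su; rewrite -mulrnDr; congr (_ *+ _).
have [/asboolP[x [y [[xy|xy] xv yu]]]|no] := boolP (meets (fun x y => E x y \/ F x y) v u).
- have -> : meets E v u by apply/asboolP; exists x, y.
  have [Fvu|//] := boolP (meets F v u).
  case: (EF x y xy); apply: (meetsP gF sv su Fvu); rewrite -?sv -?su//.
  exact: gE.1.
- have -> : meets F v u by apply/asboolP; exists x, y.
  have [Evu|//] := boolP (meets E v u).
  case: (EF x y _ xy); apply: (meetsP gE sv su Evu); rewrite -?sv -?su//.
  exact: gF.1.
rewrite (_ : meets E v u = false) 1?(_ : meets F v u = false)//.
  by apply: contraNF no => /asboolP[x [y [xy xv yu]]]; apply/asboolP; exists x, y; split; first right.
by apply: contraNF no => /asboolP[x [y [xy xv yu]]]; apply/asboolP; exists x, y; split; first left.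
Qed.

End Operators.

Section Realization.
Context {R : realType} {N : nat} {M : 'M[nat]_N} {C : cstarAlgType R}.
Variable S : 'I_N -> C.
Hypothesis M01 : zero_one_mx M.
Hypothesis CKS : CK_family M S.
Hypothesis ext : forall i, exists j, arrow M i j.
Local Notation X := (shift_space M).
Local Notation sft := (@Defs.shift _ M).
Implicit Types (x y z : X) (E F : X -> X -> Prop) (v u w : seq 'I_N) (s t : C).

(** Levels can be raised simultaneously on both sides, and the element does not
    change; [p] and [q] therefore matter only through the degree [p - q]. *)
Definition realizes p q E t := exists n0, forall n, (n0 <= n)%N ->
  level (p + n) (q + n) E /\ relop S (p + n) (q + n) E = t.

Lemma realizes_relop p q n E : level (p + n) (q + n) E ->
  realizes p q E (relop S (p + n) (q + n) E).
Proof.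
move=> gE; exists n => m /subnKC <-; elim: (m - n)%N => [|k [gk <-]]; first by rewrite addn0.
by rewrite !addnS; split; [exact: levelS|rewrite relopS].
Qed.

Lemma realizes_relop0 p q E : level p q E -> realizes p q E (relop S p q E).
Proof. by move=> gE; have := @realizes_relop p q 0 E; rewrite !addn0; apply. Qed.

Lemma realizes_inj p q E s t : realizes p q E s -> realizes p q E t -> s = t.
Proof.
move=> [m ms] [n nt]; have [|_ <-] := ms (maxn m n); first exact: leq_maxl.
by have [|_ <-] := nt (maxn m n); first exact: leq_maxr.
Qed.

Lemma realizes_shift m p q E t : realizes p q E t -> realizes (p + m) (q + m) E t.
Proof.
move=> [n nt]; exists n => k nk; rewrite -!addnA; apply: nt.
exact: leq_trans nk (leq_addl _ _).
Qed.

Lemma realizes_inverse p q E t : realizes p q E t -> realizes q p (inverse E) (star t).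
Proof.
move=> [n nt]; exists n => k /nt[gE <-].
by split; [exact: level_inverse|rewrite relop_inverse].
Qed.

Lemma realizes_comp p q r E F s t : functional E ->
  realizes p q E s -> realizes q r F t -> realizes p r (comp E F) (s * t).
Proof.
move=> fE [m ms] [n nt]; exists (maxn m n) => k; rewrite geq_max => /andP[mk nk].
have [[gE <-] [gF <-]] := (ms k mk, nt k nk).
by split; [exact: level_comp gE gF|rewrite (relop_mul CKS gE gF)].
Qed.

Lemma realizes_or p q E F s t : realizes p q E s -> realizes p q F t ->
  (forall x y, E x y -> F x y -> False) ->
  realizes p q (fun x y => E x y \/ F x y) (s + t).
Proof.
move=> [m ms] [n nt] EF; exists (maxn m n) => k; rewrite geq_max => /andP[mk nk].
have [[gE <-] [gF <-]] := (ms k mk, nt k nk).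
by split; [exact: level_or|rewrite relop_or].
Qed.

Lemma realizes_false p q : realizes p q (fun _ _ => False) 0.
Proof.
exists 0%N => n _; split; first by split.
rewrite /relop big1// => v _; rewrite big1// => u _.
by have [/asboolP[? [? []]]|] := boolP (meets _ v u).
Qed.

Lemma realizes_if (b : bool) p q E t : realizes p q E t ->
  realizes p q (fun x y => b /\ E x y) (t *+ b).
Proof.
case: b => Et; [rewrite (_ : (fun x y => _) = E)//|rewrite (_ : (fun x y => _) = fun _ _ => False)].
- by apply: relation_ext => x y; split=> [[]|].
- exact: realizes_false.
by apply: relation_ext => x y; split=> [[]|].
Qed.

Lemma realizes_sum (I : eqType) (r : seq I) p q (E : I -> X -> X -> Prop) (t : I -> C) :
  uniq r -> (forall i, i \in r -> realizes p q (E i) (t i)) ->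
  (forall i j x y, i \in r -> j \in r -> E i x y -> E j x y -> i = j) ->
  realizes p q (fun x y => exists2 i, i \in r & E i x y) (\sum_(i <- r) t i).
Proof.
elim: r => [_ _ _|i r IH /= /andP[ir ur] Et Ed].
  rewrite big_nil (_ : (fun x y => _) = fun _ _ => False); first exact: realizes_false.
  by apply: relation_ext => x y; split=> [[]|].
rewrite big_cons (_ : (fun x y => _) = fun x y => E i x y \/ exists2 j, j \in r & E j x y).
  apply: realizes_or; first by apply: Et; exact: mem_head.
    apply: IH => // [j jr|j k x y jr kr]; first by apply: Et; rewrite inE jr orbT.
    by apply: Ed; rewrite inE (jr, kr) orbT.
  move=> x y xy [j jr xy']; move: ir; rewrite (Ed _ _ _ _ _ _ xy xy') ?jr//.
    exact: mem_head.
  by rewrite inE jr orbT.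
apply: relation_ext => x y; split=> [[j]|[xy|[j jr xy]]].
- by rewrite inE => /predU1P[->|jr]; [left|right; exists j].
- by exists i; rewrite ?mem_head.
by exists j; rewrite // inE jr orbT.
Qed.

Lemma realizes_eq : realizes 0 0 (fun x y => x = y) 1.
Proof.
have := realizes_relop0 level_eq; congr realizes; rewrite /relop.
have [_ <- _] := CKS; rewrite big_words_rcons; under eq_bigr do under eq_bigr do rewrite big_words_rcons.
rewrite /words !big_seq1; apply: eq_bigr => i _; rewrite big_seq1 (bigD1 i)//= big1 ?addr0 => [|j ji].
  have [x xi] := point_from ext i.
  have -> : meets (fun x y : X => x = y) [:: i] [:: i].
    by apply/asboolP; exists x, x; rewrite /word/mkseq/= xi.
  by rewrite mulr1n !monom_seq1.
have [/asboolP[x [y [-> [yi] [yj]]]]|//] := boolP (meets _ _ _).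
by rewrite -yi -yj eqxx in ji.
Qed.

Lemma realizes_branch i : realizes 1 0 (branch i) (S i).
Proof.
have := realizes_relop0 (level_branch (M := M) i); congr realizes; rewrite /relop.
have -> : S i = \sum_j S i * (S j * star (S j)).
  by rewrite -mulr_sumr; have [_ -> _] := CKS; rewrite mulr1.
under eq_bigr do rewrite big_words_rcons.
rewrite big_words_rcons big_words_rcons /words big_seq1 (bigD1 i)//=.
rewrite [X in _ + X]big1 ?addr0; last first.
  move=> k ki; rewrite big1// => j _; rewrite big_seq1 big1// => l _.
  have [/asboolP[x [y [[xi _] /= [xk _] _]]]|//] := boolP (meets _ _ _).
  by rewrite -xk xi eqxx in ki.
apply: eq_bigr => j _; rewrite big_seq1 (bigD1 j)//= big1 ?addr0; last first.
  move=> l lj; have [/asboolP[x [y [[xi xy] /= [_ xj] [yl]]]]|//] := boolP (meets _ _ _).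
  by rewrite -yl -xy -xj eqxx in lj.
rewrite monom_cons !monom_seq1 mulrA.
have [ij|ij] := boolP (arrow M i j); last first.
  by rewrite (gen_mul0 M01 CKS ij) !mul0r mul0rn.
have [x x0 x1] := point_from2 ext ij.
rewrite (_ : meets _ _ _ = true)//; apply/asboolP; exists x, (sft x).
by split; rewrite /word/mkseq/= ?x0 ?x1// -x1.
Qed.

End Realization.

Lemma rmorph_relop (R : realType) (N : nat) (M : 'M[nat]_N) (C D : cstarAlgType R)
    (f : {lrmorphism C -> D}) (S : 'I_N -> C) (T : 'I_N -> D) a b
    (E : shift_space M -> shift_space M -> Prop) :
  star_preserving f -> (forall i, f (S i) = T i) -> f (relop S a b E) = relop T a b E.
Proof.
move=> fs fST.
have fm w : f (monom S w) = monom T w.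
  by rewrite /monom rmorph_prod; apply: eq_bigr => i _; exact: fST.
rewrite /relop raddf_sum; apply: eq_bigr => v _; rewrite raddf_sum.
by apply: eq_bigr => u _; rewrite raddfMn/= rmorphM/= fs !fm.
Qed.

(** * From an eventual conjugacy to a Cuntz-Krieger family *)

Section Transport.
Context {N N' : nat} {M : 'M[nat]_N} {M' : 'M[nat]_N'}.
Local Notation X := (shift_space M).
Local Notation X' := (shift_space M').
Local Notation sft := (@Defs.shift _ M).
Local Notation sft' := (@Defs.shift _ M').
Variables (h : X -> X') (h' : X' -> X).
Hypotheses (hK : cancel h h') (h'K : cancel h' h).

Definition transport (E : X -> X -> Prop) (z y : X') := E (h' z) (h' y).

Lemma transport_comp E F : transport (comp E F) = comp (transport E) (transport F).
Proof.
apply: relation_ext => z y; split=> [[x zx xy]|[x zx xy]]; last by exists (h' x).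
by exists (h x); rewrite /transport hK.
Qed.

Lemma transport_eq : transport (fun x y => x = y) = (fun z y => z = y).
Proof.
apply: relation_ext => z y; split=> [|-> //].
exact: (can_inj h'K).
Qed.

Lemma transport_functional E : functional E -> functional (transport E).
Proof. by move=> fE x y z xy xz; apply: (can_inj h'K); exact: fE xy xz. Qed.

(** The lag [k] is bounded by some [K], and by compactness an initial segment of [z]
    determines the first letter of [h' z] and the first [K] letters of
    [h (sft (h' z))].  The remaining letters of the latter are those of [z] shifted
    by one. *)
Lemma transport_branch_level (k : X -> nat) : continuous h -> continuous h' ->
  continuous k ->
  (forall x, iter (k x) sft' (h (sft x)) = iter (k x).+1 sft' (h x)) ->
  forall i, exists n, level n.+1 n (transport (branch i)).
Proof.
move=> /continuous_agree ch /continuous_agree ch' /continuous_nat_agree ck hk i.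
have [K kK] : exists K, forall x, (k x <= K)%N.
  apply: shift_space_uniform => [x m n mn /leq_trans|x]; first exact.
  by have [m xm] := ck x; exists m, (k x) => y /xm ->.
have hsft n x : (K <= n)%N -> iter n sft' (h (sft x)) = iter n.+1 sft' (h x).
  move=> Kn; rewrite -(subnK (leq_trans (kK x) Kn)) -addnS !iterD hk.
  by rewrite -iterD.
pose Q z z' := letter (h' z) 0 = letter (h' z') 0 /\
  agree K (h (sft (h' z))) (h (sft (h' z'))).
have [L LQ] : exists L, forall z z', agree L z z' -> Q z z'.
  apply: shift_space_uniform => [z m n mn zQ z' /(agreeW mn)/zQ//|z].
  have [m mK] := ch (sft (h' z)) K; have [l lm] := ch' z m.+1.
  have zQ z' : agree l z z' -> Q z z'.
    move=> /lm zz'; split; first exact: zz'.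
    by apply: mK => j jm; exact: (zz' j.+1).
  exists l, l => y zy z' yz'; have [y0 yK] := zQ y zy.
  have [z0 zK] := zQ z' (agree_trans zy yz').
  by split; [rewrite -y0|exact: agree_trans (agree_sym yK) zK].
(* Letters before [K] are controlled by [L], later ones by synchronisation. *)
exists (maxn K L); set n := maxn K L.
have Kn : (K <= n)%N := leq_maxl _ _.
have g1 z y : sft (h' z) = h' y -> iter n.+1 sft' z = iter n sft' y.
  by move=> zy; rewrite -[y]h'K -zy hsft// h'K.
split=> [z y [_ /g1]//|z y z' y' [zi zy] zz' yy' s].
have [z0 zK] := LQ z z' (agreeW (leq_trans (leq_maxr K L) (leqW (leqnSn _))) zz').
split; first by rewrite -z0.
(* It remains to compare [y'] with the point [y''] that [z'] is related to. *)
rewrite -[LHS]hK; congr h'; set y'' := h _.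
have zy'' : iter n.+1 sft' z' = iter n sft' y'' by apply: g1; rewrite hK.
apply: (@agree_iter_eq _ _ n) => [j jn|]; last by rewrite -zy''.
rewrite -yy'; last exact: ltnW.
have [jK|Kj] := ltnP j K.
  by rewrite -zK// zy h'K.
rewrite -[y]h'K -zy -[j in RHS]addn0 -letter_iter_shift hsft// h'K.
rewrite -[j in LHS]addn0 -letter_iter_shift hsft// h'K !letter_iter_shift.
by rewrite !addn0; apply/esym/zz'; rewrite ltnS leqW.
Qed.

End Transport.

Section Transfer.
Context {R : realType} {N N' : nat} {M : 'M[nat]_N} {M' : 'M[nat]_N'}.
Context {C : cstarAlgType R} (S : 'I_N' -> C) (T : 'I_N -> C).
Local Notation X := (shift_space M).
Local Notation X' := (shift_space M').
Local Notation sft := (@Defs.shift _ M).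
Variables (h : X -> X') (h' : X' -> X).
Hypotheses (hK : cancel h h') (h'K : cancel h' h).
Hypotheses (M01 : zero_one_mx M) (M'01 : zero_one_mx M').
Hypothesis ext : forall i, exists j, arrow M i j.
Hypothesis ext' : forall i, exists j, arrow M' i j.
Hypothesis CKS : CK_family M' S.
Hypothesis TP : forall i, realizes S 1 0 (transport h' (branch i)) (T i).

Let branch_fun i : functional (branch (M := M) i).
Proof. by move=> x y z [_ <-] [_ <-]. Qed.

Let branch_inv_fun i : functional (inverse (branch (M := M) i)).
Proof.
move=> x y z [yi yx] [zi zx]; apply: (@agree_iter_eq _ _ 1); last by rewrite /= yx zx.
by move=> k; rewrite ltnS leqn0 => /eqP->; rewrite yi zi.
Qed.

Lemma branch_range i :
  comp (branch i) (inverse (branch i)) = fun x y : X => x = y /\ letter x 0 = i.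
Proof.
apply: relation_ext => x y; split=> [[u [xi xu] [yi yu]]|[<- xi]]; last by exists (sft x).
by split=> //; apply: (@branch_inv_fun i u).
Qed.

Lemma branch_source i :
  comp (inverse (branch i)) (branch i) = fun x y : X => x = y /\ arrow M i (letter x 0).
Proof.
apply: relation_ext => x y; split=> [[u [ui <-] [_ <-]]|[<- xi]].
  by split=> //; rewrite -ui /arrow letter_admissible.
have [z zi zx] := point_from2 ext xi.
have [|u uz ux] := @splice _ _ z 1 x; first by rewrite zx.
by exists u; split; rewrite // -uz.
Qed.

Let range_T i :
  realizes S 1 1 (transport h' (fun x y => x = y /\ letter x 0 = i)) (T i * star (T i)).
Proof.
rewrite -branch_range (transport_comp hK).
apply: (realizes_comp CKS _ (TP i)); first exact: transport_functional.
exact: realizes_inverse (TP i).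
Qed.

(** Each Cuntz-Krieger relation is an identity between relations on points: [branch i]
    composed with its inverse is the identity of the cylinder of [i], and the inverse
    composed with [branch i] is the identity of the union of the cylinders of the
    letters that can follow [i]. *)
Lemma transfer_CK_family : CK_family M T.
Proof.
split=> [i||i].
- apply: (realizes_inj _ (TP i)).
  rewrite (_ : branch i = comp (fun x y => x = y /\ letter x 0 = i) (branch i)).
    rewrite (transport_comp hK); apply: (realizes_comp CKS _ (range_T i) (TP i)).
    by apply: transport_functional => // x y z [<- _] [<- _].
  apply: relation_ext => x y; split=> [[xi xy]|[u [<- _]]//].
  by exists x.
- have sumT : realizes S 1 1 (fun z y => exists2 j, j \in index_enum 'I_N &
      transport h' (fun x y => x = y /\ letter x 0 = j) z y) (\sum_j T j * star (T j)).
    apply: realizes_sum => [|j _|i j x y _ _ [_ <-] [_ <-]//].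
    - exact: index_enum_uniq.
    - exact: range_T.
  apply: (realizes_inj sumT); rewrite (_ : (fun z y => _) = fun z y => z = y).
    exact: (realizes_shift 1 (realizes_eq M'01 CKS ext')).
  apply: relation_ext => z y; split=> [[j _ [/(can_inj h'K)]]//|->].
  by exists (letter (h' y) 0); rewrite ?mem_index_enum.
have := realizes_comp CKS _ (realizes_inverse (TP i)) (TP i).
rewrite -[inverse _]/(transport h' (inverse (branch i))) -(transport_comp hK).
move=> /(_ (transport_functional h'K (@branch_inv_fun i))) /(realizes_shift 1).
rewrite branch_source !add0n => /realizes_inj; apply.
have MP j : M i j = arrow M i j.
  by have [/eqP|/(arrowN M01)->] := boolP (arrow M i j).
under eq_bigr do rewrite MP.
have sumT : realizes S 1 1 (fun z y => exists2 j, j \in index_enum 'I_N &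
    arrow M i j /\ transport h' (fun x y => x = y /\ letter x 0 = j) z y)
    (\sum_j (T j * star (T j)) *+ arrow M i j).
  apply: realizes_sum => [|j _|k j x y _ _ [_ [_ <-]] [_ [_ <-]]//].
  - exact: index_enum_uniq.
  - exact: realizes_if.
move: sumT; congr realizes; apply: relation_ext => z y.
split=> [[j _ [ij [zy zj]]]|[zy ij]]; first by split; rewrite ?zj.
by exists (letter (h' z) 0); rewrite ?mem_index_enum.
Qed.

(** The relation implemented by [monom w]. *)
Definition walk w (x y : X) := word x (size w) = w /\ iter (size w) sft x = y.

Lemma walk_cons i w : walk (i :: w) = comp (branch i) (walk w).
Proof.
apply: relation_ext => x y; rewrite /walk /= word_cons -iterS iterSr.
by split=> [[[xi xw] xy]|[_ [<- <-] [-> <-]]//]; exists (sft x).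
Qed.

Lemma walk_functional w : functional (walk w).
Proof. by move=> x y z [_ <-] [_ <-]. Qed.

Lemma realizes_walk w : realizes S (size w) 0 (transport h' (walk w)) (monom T w).
Proof.
elim: w => [|i w IH].
  rewrite monom_nil (_ : walk [::] = fun x y => x = y).
    by rewrite (transport_eq h'K); exact: realizes_eq.
  by apply: relation_ext => x y; split=> [[]|].
rewrite walk_cons monom_cons (transport_comp hK).
have := realizes_shift (size w) (TP i); rewrite add1n add0n => Ti.
by apply: (realizes_comp CKS _ Ti IH); exact: transport_functional.
Qed.

(** A relation of level [(a, b)] is the disjoint union of the relations [Z v u]
    over the pairs of words that it meets, and [Z v u] is implemented by
    [monom v * star (monom u)]. *)
Lemma realizes_transfer_relop a b (E : X -> X -> Prop) : level a b E ->
  realizes S a.+1 b.+1 (transport h' E) (relop T a b E).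
Proof.
move=> gE; pose Z v u := comp (walk v) (inverse (walk u)).
have Zvu v u : size v = a.+1 -> size u = b.+1 ->
    realizes S a.+1 b.+1 (transport h' (Z v u)) (monom T v * star (monom T u)).
  move=> sv su; rewrite -{1}sv -{1}su /Z (transport_comp hK).
  apply: (realizes_comp CKS _ (realizes_walk v)).
    by apply: transport_functional => //; exact: walk_functional.
  exact: realizes_inverse (realizes_walk u).
have sum_u v : size v = a.+1 -> realizes S a.+1 b.+1
    (fun z y => exists2 u, u \in words b.+1 & meets E v u /\ transport h' (Z v u) z y)
    (\sum_(u <- words b.+1) (monom T v * star (monom T u)) *+ meets E v u).
  move=> sv; apply: realizes_sum => [|u|u w x y].
  - exact: uniq_words.
  - by rewrite mem_words => /eqP su; exact/realizes_if/Zvu.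
  rewrite !mem_words => /eqP su /eqP sw [_ [t _ [<- _]]] [_ [t' _ [<- _]]].
  by rewrite su sw.
have sum_v : realizes S a.+1 b.+1 (fun z y => exists2 v, v \in words a.+1 &
    exists2 u, u \in words b.+1 & meets E v u /\ transport h' (Z v u) z y) (relop T a b E).
  apply: realizes_sum => [|v|v w x y].
  - exact: uniq_words.
  - by rewrite mem_words => /eqP; exact: sum_u.
  rewrite !mem_words => /eqP sv /eqP sw [? _ [_ [? [<- _] _]]] [? _ [_ [? [<- _] _]]].
  by rewrite sv sw.
move: sum_v; congr realizes; apply: relation_ext => z y'.
suff EE x y : E x y <-> exists2 v, v \in words a.+1 &
    exists2 u, u \in words b.+1 & meets E v u /\ Z v u x y.
  exact: iff_sym (EE (h' z) (h' y')).
split=> {z y'} [xy|[v]].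
  exists (word x a.+1); first by rewrite mem_words size_word.
  exists (word y b.+1); first by rewrite mem_words size_word.
  split; first by apply/asboolP; exists x, y; rewrite !size_word.
  by exists (iter a.+1 sft x); rewrite /inverse /walk ?size_word//= (gE.1 _ _ xy).
rewrite mem_words => /eqP sv [u]; rewrite mem_words => /eqP su [vu].
case=> z [xv xz] [yu yz]; apply: (meetsP gE sv su vu); rewrite -?sv -?su//.
have := meets_last gE sv su vu (letter x 0).
rewrite -xv -yu sv su !last_word => xy.
apply: (@agree_iter_eq _ _ 1) => [k|].
  by rewrite ltnS leqn0 => /eqP->; rewrite !letter_iter_shift !addn0.
by rewrite /= -!iterS -sv -su xz yz.
Qed.

End Transfer.

(** * From an eventual conjugacy to an isomorphism *)

Section CKAlgebra.
Context {R : realType} {N : nat} {M : 'M[nat]_N} (O : CK_algebra (R := R) M).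
Hypothesis M01 : zero_one_mx M.

(** This is the uniqueness half of the universal property, for homomorphisms whose
    common values on the generators are not given in advance. *)
Lemma CK_hom_eq (B : cstarAlgType R) (f g : {lrmorphism O -> B}) :
  star_preserving f -> star_preserving g ->
  (forall i, f (CK_gen O i) = g (CK_gen O i)) -> f =1 g.
Proof.
move=> fs gs fg.
have CKf : CK_family M (fun i => f (CK_gen O i)).
  have [pS sS rS] := CK_genP O; split=> [i||i].
  - by rewrite -fs -!rmorphM pS.
  - rewrite -(rmorph1 f) -sS rmorph_sum; apply: eq_bigr => i _.
    by rewrite rmorphM/= fs.
  - rewrite -fs -rmorphM rS rmorph_sum; apply: eq_bigr => j _.
    by rewrite rmorphMn/= rmorphM/= fs.
have [k [_ _ kU]] := CK_universal O CKf.
by move=> x; rewrite (kU f)// (kU g).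
Qed.

Lemma gauge_monom t w :
  gauge O t (monom (CK_gen O) w) = circle_exp t ^+ size w *: monom (CK_gen O) w.
Proof.
elim: w => [|i w IH]; first by rewrite monom_nil rmorph1 expr0 scale1r.
rewrite monom_cons rmorphM/= gauge_gen IH/= -scalerAl -scalerAr scalerA.
by rewrite -exprS.
Qed.

Lemma gauge_monom_pair t v u :
  gauge O t (monom (CK_gen O) v * star (monom (CK_gen O) u)) =
  (circle_exp t ^+ size v * conjc (circle_exp t) ^+ size u) *:
    (monom (CK_gen O) v * star (monom (CK_gen O) u)).
Proof.
rewrite rmorphM/= gauge_star !gauge_monom/= starZ -scalerAl -scalerAr scalerA.
by rewrite rmorphXn.
Qed.

Lemma gauge_relop t n E :
  gauge O t (relop (M := M) (CK_gen O) n.+1 n E) = circle_exp t *: relop (CK_gen O) n.+1 n E.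
Proof.
rewrite /relop rmorph_sum scaler_sumr; apply: eq_big_words => v sv.
rewrite rmorph_sum scaler_sumr; apply: eq_big_words => u su.
rewrite rmorphMn/= gauge_monom_pair scalerMnr sv su exprS -mulrA -exprMn.
by rewrite [X in X ^+ _]mulrC circle_exp_conj expr1n mulr1.
Qed.

Lemma diagonal_subalgebra : cstar_subalgebra (CK_diagonal O).
Proof.
pose G := [set p | exists2 w, w != [::] & p = CK_word O w * star (CK_word O w)].
split.
- by move=> D [[] ? ? ? ? ? _].
- by move=> a x y Dx Dy D [+ GD]; move=> sD; have [_ + _ _ _] := sD; apply; [apply: Dx|apply: Dy].
- by move=> x y Dx Dy D [+ GD]; move=> sD; have [_ _ + _ _] := sD; apply; [apply: Dx|apply: Dy].
- by move=> x Dx D [+ GD]; move=> sD; have [_ _ _ + _] := sD; apply; apply: Dx.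
- apply: closed_bigI => D [sD _]; by have [] := sD.
Qed.

Lemma diagonal_cylproj w : w != [::] -> CK_diagonal O (cylproj (CK_gen O) w).
Proof. by move=> w0 D [_ GD]; apply: GD; exists w. Qed.

Lemma diagonal_relop n (E : shift_space M -> shift_space M -> Prop) :
  (forall x y, E x y -> x = y) -> CK_diagonal O (relop (CK_gen O) n n E).
Proof.
have [D0 Dlin _ _ _] := diagonal_subalgebra.
have Dsum (r : seq (seq 'I_N)) (F : seq 'I_N -> O) :
    (forall w, w \in r -> CK_diagonal O (F w)) -> CK_diagonal O (\sum_(w <- r) F w).
  move=> DF; rewrite big_seq; elim/big_ind: _ => // x y Dx Dy.
  by rewrite -[x]scale1r; exact: Dlin.
move=> Eeq; apply: (Dsum) => v; rewrite mem_words => /eqP sv.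
apply: (Dsum) => u; rewrite mem_words => /eqP su.
have [/asboolP[x [y [/Eeq -> <- <-]]]|//] := boolP (meets E v u).
rewrite sv su mulr1n; apply: diagonal_cylproj.
by rewrite -size_eq0 size_word.
Qed.

End CKAlgebra.

Section TransferHom.
Context {R : realType} {N N' : nat} {M : 'M[nat]_N} {M' : 'M[nat]_N'}.
Hypotheses (M01 : zero_one_mx M) (M'01 : zero_one_mx M').
Hypothesis ext : forall i, exists j, arrow M i j.
Hypothesis ext' : forall i, exists j, arrow M' i j.
Variables (O : CK_algebra (R := R) M) (O' : CK_algebra (R := R) M').
Variables (h : shift_space M -> shift_space M') (h' : shift_space M' -> shift_space M).
Hypotheses (hK : cancel h h') (h'K : cancel h' h).

Definition implements (f : O -> O') :=
  forall i, realizes (CK_gen O') 1 0 (transport h' (branch i)) (f (CK_gen O i)).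

Lemma implementing_hom (k : shift_space M -> nat) :
  continuous h -> continuous h' -> continuous k ->
  (forall x, iter (k x) (@Defs.shift _ M') (h (Defs.shift x)) =
             iter (k x).+1 (@Defs.shift _ M') (h x)) ->
  exists f : {lrmorphism O -> O'}, star_preserving f /\ implements f.
Proof.
move=> ch ch' ck hk.
have /choice[T TP] i : exists t : O', realizes (CK_gen O') 1 0 (transport h' (branch i)) t.
  have [n gn] := transport_branch_level hK h'K ch ch' ck hk i.
  exists (relop (CK_gen O') (1 + n) (0 + n) (transport h' (branch i))).
  by apply: (realizes_relop M'01 (CK_genP O') ext').
have [f [fs fT _]] := CK_universal O
  (transfer_CK_family hK h'K M01 M'01 ext ext' (CK_genP O') TP).
by exists f; split=> // i; rewrite fT.
Qed.

Variable f : {lrmorphism O -> O'}.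
Hypothesis fs : star_preserving f.
Hypothesis fP : implements f.

Lemma implements_gauge t : f \o gauge O t =1 gauge O' t \o f.
Proof.
apply: (CK_hom_eq (f := f \o gauge O t) (g := gauge O' t \o f)).
- by move=> x; rewrite /= gauge_star fs.
- by move=> x; rewrite /= fs gauge_star.
move=> i /=; rewrite gauge_gen linearZ/=.
by have [n /(_ n (leqnn n))[_ <-]] := fP i; rewrite add0n add1n gauge_relop.
Qed.

(** The diagonal of [O'] is closed and [f] is contractive, so it suffices to treat
    [cylproj w], whose image realizes a part of the identity relation. *)
Lemma implements_diagonal x : CK_diagonal O x -> CK_diagonal O' (f x).
Proof.
have [D0 Dlin Dmul Dstar Dcl] := diagonal_subalgebra O'.
move=> /(_ (f @^-1` CK_diagonal O')); apply; split; first split.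
- by rewrite /= raddf0.
- by move=> a y z Dy Dz; rewrite /= linearP; exact: Dlin.
- by move=> y z Dy Dz; rewrite /= rmorphM; exact: Dmul.
- by move=> y Dy; rewrite /= fs; exact: Dstar.
- apply/closed_nrmP => y yD /=; move/closed_nrmP: Dcl; apply => e /yD[z Dz yz].
  exists (f z) => //; rewrite -raddfB; apply: le_lt_trans yz.
  exact: starhom_contractive.
move=> _ [w _ ->] /=; pose T i := f (CK_gen O i).
have fw : f (CK_word O w) = monom T w by rewrite rmorph_prod.
rewrite rmorphM/= fs fw.
have rw := realizes_walk hK h'K M'01 ext' (CK_genP O') fP w.
have [|n /(_ n (leqnn n))[_ <-]] := realizes_comp (CK_genP O') _ rw (realizes_inverse rw).
  by apply: transport_functional => //; exact: walk_functional.
apply: diagonal_relop => z y [u [zw zu] [yw yu]]; apply: (can_inj h'K).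
apply: (@agree_iter_eq _ _ (size w)); last by rewrite zu yu.
by apply/word_agree; rewrite zw yw.
Qed.

End TransferHom.

(** The image of a generator under [g \o f] is realized by [branch i] transported
    forth and back. *)
Lemma implements_inverse (R : realType) (N N' : nat) (M : 'M[nat]_N) (M' : 'M[nat]_N')
    (M01 : zero_one_mx M) (M'01 : zero_one_mx M')
    (ext : forall i, exists j, arrow M i j) (ext' : forall i, exists j, arrow M' i j)
    (O : CK_algebra (R := R) M) (O' : CK_algebra (R := R) M')
    (h : shift_space M -> shift_space M') (h' : shift_space M' -> shift_space M)
    (hK : cancel h h') (h'K : cancel h' h)
    (f : {lrmorphism O -> O'}) (g : {lrmorphism O' -> O}) :
  star_preserving f -> star_preserving g ->
  implements h' f -> implements h g -> cancel f g.
Proof.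
move=> fs gs fP gP; apply: (CK_hom_eq (f := g \o f) (g := idfun)) => //.
  by move=> x; rewrite /= fs gs.
move=> i /=; have [n /(_ n (leqnn n))[gE <-]] := fP i.
rewrite (rmorph_relop _ _ _ gs (fun=> erefl)).
have := realizes_transfer_relop h'K hK M01 ext (CK_genP O) gP gE.
rewrite (_ : transport h _ = branch i); last first.
  by apply: relation_ext => x y; rewrite /transport !hK.
move/realizes_inj; apply.
by have := realizes_shift n.+1 (realizes_branch M01 (CK_genP O) ext i); rewrite !addnS.
Qed.

(** An eventual conjugacy and its inverse give homomorphisms in both directions. *)
Lemma eventually_conjugate_iso (R : realType) (N1 N2 : nat)
    (A : 'M[nat]_N1) (B : 'M[nat]_N2) (A01 : zero_one_mx A) (B01 : zero_one_mx B)
    (extA : forall i, exists j, arrow A i j) (extB : forall i, exists j, arrow B i j)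
    (OA : CK_algebra (R := R) A) (OB : CK_algebra (R := R) B) :
  eventually_conjugate A B ->
  exists Phi : {lrmorphism OA -> OB},
     [/\ bijective Phi,
         star_preserving Phi,
         Phi @` CK_diagonal OA = CK_diagonal OB
       & forall t : R, Phi \o gauge OA t =1 gauge OB t \o Phi].
Proof.
move=> [h [h' [k1 [k2 [[hK h'K ch ch'] ck1 ck2 hk1 hk2]]]]].
have [f [fs fP]] := implementing_hom A01 B01 extA extB OA OB hK h'K ch ch' ck1 hk1.
have [g [gs gP]] := implementing_hom B01 A01 extB extA OB OA h'K hK ch' ch ck2 hk2.
have fK : cancel f g by apply: (implements_inverse _ _ _ _ hK h'K).
have gK : cancel g f by apply: (implements_inverse _ _ _ _ h'K hK).
exists f; split=> //; first by exists g.
- apply/seteqP; split=> [_ [x Dx <-]|y Dy]; first exact: (implements_diagonal _ _ hK h'K).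
  by exists (g y); rewrite ?gK//; apply: (implements_diagonal _ _ h'K hK).
exact: implements_gauge.
Qed.

(** * Elements of gauge degree one *)

Section StarClosure.
Context {R : realType} {A : cstarAlgType R}.

Lemma approximable_subalgebra (D : set A) :
  D 0 -> (forall (a : R[i]) x y, D x -> D y -> D (a *: x + y)) ->
  (forall x y, D x -> D y -> D (x * y)) -> (forall x, D x -> D (star x)) ->
  cstar_subalgebra [set x | forall e : R, 0 < e -> exists2 y, D y & nrm (x - y) < e].
Proof.
move=> D0 Dlin Dmul Dstar; split=> /=.
- by move=> e e0; exists 0; rewrite // subrr nrm0.
- move=> a x y Dx Dy e e0; have a0 : 0 <= complex.Re `|a| by rewrite -ler0c RRe_real ?normr_real.
  have [|x' Dx' xx'] := Dx (e / (2 * (complex.Re `|a| + 1))).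
    by rewrite divr_gt0//; lra.
  have [|y' Dy' yy'] := Dy (e / 2); first by lra.
  exists (a *: x' + y'); first exact: Dlin.
  rewrite opprD addrACA -scalerBr; apply: le_lt_trans (nrmD _ _) _; rewrite nrmZ.
  move: xx'; rewrite ltr_pdivlMr; last by lra.
  by have := nrm_ge0 (x - x'); nra.
- move=> x y Dx Dy e e0; have x0 := nrm_ge0 x; have y0 := nrm_ge0 y.
  have [|y' Dy' yy'] := Dy (Num.min 1 (e / (2 * (nrm x + 1)))).
    by rewrite lt_min ltr01 divr_gt0//; lra.
  have [|x' Dx' xx'] := Dx (e / (2 * (nrm y + 2))); first by rewrite divr_gt0//; lra.
  exists (x' * y'); first exact: Dmul.
  apply: le_lt_trans (nrm_split (x * y') _ _) _; rewrite -mulrBr -mulrBl.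
  move: yy' xx'; rewrite lt_min => /andP[y1]; rewrite !ltr_pdivlMr; [|lra|lra].
  move=> yy' xx'; have y'1 : nrm y' <= nrm y + 1.
    have := nrmB y (y - y'); rewrite opprB addrC subrK => /le_trans; apply.
    by rewrite lerD2l ltW.
  have := nrmM x (y - y'); have := nrmM (x - x') y'.
  have := nrm_ge0 y'; have := nrm_ge0 (x - x'); have := nrm_ge0 (y - y').
  nra.
- by move=> x Dx e /Dx[y Dy xy]; exists (star y); [exact: Dstar|rewrite -starB nrm_star].
apply/closed_nrmP => x xD e e0; have [|y /(_ (e / 2))] := xD (e / 2); first by lra.
have e2 : 0 < e / 2 by lra.
move=> /(_ e2)[z Dz yz] xy; exists z => //.
by apply: le_lt_trans (nrm_split y _ _) _; lra.
Qed.

End StarClosure.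

Section Circle.
Context {R : realType}.
Implicit Types s t : R.

Lemma circle_expD s t : circle_exp (s + t) = circle_exp s * circle_exp t.
Proof.
apply/eqP; rewrite /circle_exp mulrDr cosD sinD eq_complex /=.
by rewrite eqxx [X in _ == X]addrC eqxx.
Qed.

Lemma circle_expMn t n : circle_exp (t *+ n) = circle_exp t ^+ n.
Proof.
elim: n => [|n IH]; last by rewrite mulrS circle_expD IH exprS.
by rewrite mulr0n /circle_exp mulr0 cos0 sin0.
Qed.

Lemma circle_exp_half : circle_exp (2^-1 : R) = -1.
Proof.
rewrite /circle_exp mulrAC mulfV ?pnatr_eq0// mul1r cospi sinpi.
by apply/eqP; rewrite eq_complex /= oppr0 !eqxx.
Qed.

(** Take [t] such that the difference of the exponents times [t] is a half turn. *)
Lemma circle_exp_separates m n : m != n ->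
  exists t, circle_exp t ^+ m = - circle_exp t ^+ n.
Proof.
have aux k l : (l < k)%N -> exists t, circle_exp t ^+ k = - circle_exp t ^+ l.
  move=> lk; pose t : R := 2^-1 / (k - l)%:R; exists t.
  have kl : (k - l)%:R != 0 :> R by rewrite pnatr_eq0 subn_eq0 -ltnNge.
  have e1 : circle_exp t ^+ (k - l) = -1.
    by rewrite -circle_expMn -mulr_natr mulfVK// circle_exp_half.
  by rewrite -[in LHS](subnK (ltnW lk)) exprD e1 mulN1r.
rewrite neq_ltn => /orP[/aux[t tE]|/aux//].
by exists t; rewrite tE opprK.
Qed.

End Circle.

Section Polynomials.
Context {R : realType} {N : nat} {M : 'M[nat]_N} (O : CK_algebra (R := R) M).
Hypothesis M01 : zero_one_mx M.
Local Notation S := (CK_gen O).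
Local Notation "'sS' w" := (star (monom S w)) (at level 10).
Let CKS := CK_genP O.

Definition combination (p : seq (R[i] * (seq 'I_N * seq 'I_N))) : O :=
  \sum_(m <- p) m.1 *: (monom S m.2.1 * sS m.2.2).

Definition polynomial (x : O) := exists p, x = combination p.

Let polynomial0 : polynomial 0.
Proof. by exists [::]; rewrite /combination big_nil. Qed.

Let polynomialD x y : polynomial x -> polynomial y -> polynomial (x + y).
Proof. by move=> [p ->] [q ->]; exists (p ++ q); rewrite /combination big_cat. Qed.

Let polynomialZ c x : polynomial x -> polynomial (c *: x).
Proof.
move=> [p ->]; exists [seq (c * m.1, m.2) | m <- p].
by rewrite /combination big_map scaler_sumr; apply: eq_bigr => m _; rewrite scalerA.
Qed.

Let polynomial_sum (I : Type) (r : seq I) (F : I -> O) :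
  (forall i, polynomial (F i)) -> polynomial (\sum_(i <- r) F i).
Proof. by move=> FP; elim/big_ind: _. Qed.

Let polynomial_term v u : polynomial (monom S v * sS u).
Proof. by exists [:: (1, (v, u))]; rewrite /combination big_seq1 scale1r. Qed.

Let polynomial_genM i x : polynomial x -> polynomial (S i * x).
Proof.
move=> [p ->]; rewrite mulr_sumr; apply: polynomial_sum => m.
by rewrite -scalerAr mulrA -monom_cons; apply: polynomialZ.
Qed.

Let polynomial_stargenM i x : polynomial x -> polynomial (star (S i) * x).
Proof.
move=> [p ->]; rewrite mulr_sumr; apply: polynomial_sum => -[c [v u]] /=.
rewrite -scalerAr; apply: polynomialZ; elim: v i => [|j v IH] i.
  rewrite monom_nil mul1r -starM -monom_rcons -[star _]mul1r -(monom_nil S).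
  exact: polynomial_term.
have [<-{j}|ij] := eqVneq i j; last first.
  by rewrite monom_cons !mulrA (gen_orth CKS)// !mul0r.
have [_ _ rS] := CKS; rewrite monom_cons !mulrA rS !mulr_suml.
apply: polynomial_sum => j; rewrite !mulrnAl -!mulrA -scaler_nat.
exact/polynomialZ/polynomial_genM/IH.
Qed.

Let polynomialM x y : polynomial x -> polynomial y -> polynomial (x * y).
Proof.
move=> [p ->] Py; rewrite mulr_suml; apply: polynomial_sum => -[c [v u]] /=.
rewrite -scalerAl -mulrA; apply: polynomialZ.
have : polynomial (sS u * y).
  elim: u y Py => [|i u IH] y Py; first by rewrite monom_nil star1 mul1r.
  by rewrite monom_cons starM -mulrA; apply/IH/polynomial_stargenM.
elim: v (sS u * y) => [|i v IH] z Pz; first by rewrite monom_nil mul1r.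
by rewrite monom_cons -mulrA; exact/polynomial_genM/IH.
Qed.

Let polynomial_star x : polynomial x -> polynomial (star x).
Proof.
move=> [p ->]; rewrite star_sum; apply: polynomial_sum => m.
by rewrite starZ starM starK; apply: polynomialZ.
Qed.

Lemma polynomial_dense x e : 0 < e -> exists p, nrm (x - combination p) < e.
Proof.
pose D := [set x | forall e : R, 0 < e -> exists2 y, polynomial y & nrm (x - y) < e].
have DS : cstar_subalgebra D /\ range S `<=` D.
  split=> [|_ [i _ <-] d d0].
    apply: approximable_subalgebra => // a y z Py Pz.
    by apply: polynomialD => //; exact: polynomialZ.
  exists (S i); last by rewrite subrr nrm0.
  by rewrite -[S i]mulr1 -star1 -(monom_nil S) -monom_seq1; exact: polynomial_term.
move=> e0; have : cstar_generated (range S) x by rewrite CK_generated.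
by move=> /(_ D DS e e0)[_ [p ->] xp]; exists p.
Qed.

Definition degree_one (m : R[i] * (seq 'I_N * seq 'I_N)) :=
  size m.2.1 == (size m.2.2).+1.

(** The norm-decreasing map [x |-> (x + conjc (e t) *: gauge t x) / 2], with
    [e t = circle_exp t], fixes [T] and multiplies every term by a scalar; by the
    choice of [t] it kills a term of degree other than one.  Terms of wrong degree
    are removed in this way one after the other. *)
Lemma degree_one_combination (T : O) p :
  (forall t, gauge O t T = circle_exp t *: T) ->
  exists2 q, all degree_one q & nrm (T - combination q) <= nrm (T - combination p).
Proof.
move=> gT; have [n] := ubnP (count (predC degree_one) p); elim: n p => // n IH p.
rewrite ltnS => pn; have [dp|] := boolP (all degree_one p); first by exists p.
rewrite -has_predC => /hasP[m0 m0p m01].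
have [t tE] := circle_exp_separates (R := R) m01.
pose e := circle_exp t; have ee : conjc e * e = 1 by exact: circle_exp_conj.
pose h : R[i] := (2^-1 : R)%:C%C.
have hh (x : O) : h *: (x + x) = x.
  rewrite -mulr2n -scaler_nat scalerA -(rmorph_nat (@real_complex_def R _)).
  by rewrite -rmorphM/= mulVf ?pnatr_eq0// scale1r.
pose c (m : R[i] * (seq 'I_N * seq 'I_N)) :=
  h * (1 + conjc e * (e ^+ size m.2.1 * conjc e ^+ size m.2.2)).
pose A (x : O) := h *: (x + conjc e *: gauge O t x).
have AD x y : A (x + y) = A x + A y.
  by rewrite /A rmorphD/= (scalerDr (conjc e)) addrACA (scalerDr h).
have AZ a x : A (a *: x) = a *: A x.
  rewrite /A linearZ/= (scalerA _ a) (mulrC _ a) -scalerA -scalerDr.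
  by rewrite scalerA mulrC -scalerA.
have AT : A T = T by rewrite /A gT scalerA ee scale1r.
have Aterm v u a : A (monom S v * sS u) = c (a, (v, u)) *: (monom S v * sS u).
  by rewrite /A gauge_monom_pair scalerA -{1}[monom S v * sS u]scale1r -scalerDl scalerA.
have Acomb : A (combination p) = combination [seq (m.1 * c m, m.2) | m <- p & c m != 0].
  elim: (p) => [|[a [v u]] q IHq].
    by rewrite /combination !big_nil /A raddf0 scaler0 addr0 scaler0.
  rewrite /combination big_cons AD IHq AZ (Aterm v u a) scalerA /=.
  have [cm|cm] := eqVneq (c (a, (v, u))) 0; first by rewrite cm mulr0 scale0r add0r.
  by rewrite /= big_cons.
have nA x : nrm (A x) <= nrm x.
  rewrite /A nrmZr ger0_norm ?invr_ge0//.
  have := nrmD x (conjc e *: gauge O t x); rewrite nrmZ.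
  have -> : complex.Re `|conjc e| = 1.
    by rewrite normc_def/= sqrrN cos2Dsin2 sqrtr1.
  by have := starhom_contractive (@gauge_star _ _ _ O t) x; lra.
have cm0 : c m0 = 0.
  rewrite /c -/e tE exprS -/e mulNr mulrN -(mulrA e) -exprMn (mulrC e (conjc e)) ee.
  by rewrite expr1n mulr1 ee subrr mulr0.
have [|q dq qle] := IH [seq (m.1 * c m, m.2) | m <- p & c m != 0].
  rewrite count_map count_filter; apply: leq_trans pn.
  rewrite !(permP (perm_to_rem m0p)) /= cm0 eqxx andbF add0n.
  move: m01; rewrite /= => ->; rewrite add1n ltnS.
  by apply: sub_count => m /andP[].
exists q => //; apply: le_trans qle _.
have AB : A (T - combination p) = T - A (combination p).
  by rewrite AD -scaleN1r AZ scaleN1r AT.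
by rewrite -Acomb -AB.
Qed.

End Polynomials.

Section Lag.
Context {R : realType} {N : nat} {M : 'M[nat]_N} (O : CK_algebra (R := R) M).
Hypothesis M01 : zero_one_mx M.
Local Notation S := (CK_gen O).
Local Notation P := (cylproj (CK_gen O)).
Local Notation sft := (@Defs.shift _ M).
Let CKS := CK_genP O.

Lemma star_monom_mul v w : (size v < size w)%N ->
  star (monom S v) * monom S w = 0 \/
  star (monom S v) * monom S w = monom S (drop (size v) w).
Proof.
elim: v w => [|i v IH] w; first by rewrite monom_nil star1 mul1r drop0; right.
case: w => // j w /=; rewrite ltnS => vw; rewrite !monom_cons starM.
rewrite -mulrA (mulrA (star (S i))).
have [<-{j}|ij] := eqVneq i j; last by left; rewrite (gen_orth CKS)// mul0r mulr0.
case: w vw => // k w vw; rewrite monom_cons (mulrA _ (S k)) (source_gen CKS).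
rewrite mulrnAl mulrnAr -monom_cons; have [ij|/(arrowN M01)->] := boolP (arrow M i k).
  by rewrite (eqP ij); exact: IH.
by left.
Qed.

(** If the tails of [y] and [x] differ, then so do their words of suitable lengths
    once [u] and [v] have been cancelled from them. *)
Lemma term_vanishes v u x y : size v = (size u).+1 ->
    iter (size u) sft y <> iter (size u).+1 sft x ->
  exists n0, forall n, (n0 <= n)%N ->
    P (word x n.+1) * (monom S v * star (monom S u)) * P (word y n) = 0.
Proof.
move=> sv /eqP yx; have [k yxk] : exists k, letter y (size u + k) != letter x (size v + k).
  apply: contrapT => /forallNP eq_at; case/eqP: yx; apply: shift_space_eq => k.
  rewrite !letter_iter_shift -sv; apply/eqP/negP => ne; apply: (eq_at k).
  exact/negP.
exists (size u + k).+1 => n nk.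
have yu : (size u < size (word y n))%N by rewrite size_word; lia.
have xv : (size v < size (word x n.+1))%N by rewrite size_word; lia.
set mx := monom S (word x n.+1); set my := monom S (word y n).
suff mid0 : star (star (monom S v) * mx) * (star (monom S u) * my) = 0.
  transitivity (mx * (star (star (monom S v) * mx) * (star (monom S u) * my)) * star my).
    by rewrite starM starK /cylproj !mulrA.
  by rewrite mid0 mulr0 mul0r.
have [->|->] := star_monom_mul xv; first by rewrite star0 mul0r.
have [->|->] := star_monom_mul yu; first by rewrite mulr0.
rewrite (monom_orth CKS)//.
  by rewrite !size_drop !size_word; lia.
apply: contra_neq yxk => /(congr1 (fun w => nth (letter x 0) w k)).
by rewrite !nth_drop !nth_mkseq//; lia.
Qed.

Lemma combination_lag p : all (@degree_one R N) p ->
  exists K, forall x y, iter K sft y <> iter K.+1 sft x ->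
    exists n0, forall n, (n0 <= n)%N ->
      P (word x n.+1) * combination O p * P (word y n) = 0.
Proof.
have mono k l x y : (k <= l)%N -> iter k sft y = iter k.+1 sft x ->
    iter l sft y = iter l.+1 sft x.
  by move=> /subnK <- yx; rewrite -addnS !iterD yx.
elim: p => [_|[c [v u]] p IH /= /andP[/eqP/= vu /IH[K KP]]].
  by exists 0%N => x y _; exists 0%N => n _; rewrite /combination big_nil mulr0 mul0r.
exists (maxn K (size u)) => x y yx.
have [|n1 n1P] := KP x y.
  by move=> e; apply: yx; exact: mono (leq_maxl _ _) e.
have [|n2 n2P] := @term_vanishes v u x y vu.
  by move=> e; apply: yx; exact: mono (leq_maxr _ _) e.
exists (maxn n1 n2) => n; rewrite geq_max => /andP[nn1 nn2].
rewrite /combination big_cons mulrDr mulrDl -/(combination O p) n1P// addr0 /=.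
by rewrite -scalerAr -scalerAl n2P// scaler0.
Qed.

(** A linear combination of terms of degree one at distance less than 1 from [T]
    involves only finitely many words; [K] is the largest length of
    their second words. *)
Lemma degree_one_lag (T : O) : (forall t, gauge O t T = circle_exp t *: T) ->
  exists K, forall x y, iter K sft y <> iter K.+1 sft x ->
    exists n, nrm (P (word x n.+1) * T * P (word y n)) < 1.
Proof.
move=> gT; have [p0 p0T] := polynomial_dense T ltr01.
have [p dp pT] := degree_one_combination p0 gT.
have [K KP] := combination_lag dp; exists K => x y /KP[n /(_ n (leqnn n)) Pp].
exists n; rewrite -[T](subrK (combination O p)) mulrDr mulrDl Pp addr0.
have P1 w : nrm (P w) <= 1 by apply/nrm_projection_le1/cylproj_proj/CKS.
apply: le_lt_trans (nrmM _ _) _.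
have := nrmM (P (word x n.+1)) (T - combination O p).
have := nrm_ge0 (P (word x n.+1) * (T - combination O p)).
have := nrm_ge0 (P (word x n.+1)); have := nrm_ge0 (P (word y n)).
have := P1 (word x n.+1); have := P1 (word y n).
have := nrm_ge0 (T - combination O p); nra.
Qed.

End Lag.

(** * Projections of the diagonal *)

Section DiagonalProjections.
Context {R : realType} {N : nat} {M : 'M[nat]_N} (O : CK_algebra (R := R) M).
Hypothesis M01 : zero_one_mx M.
Local Notation P := (cylproj (CK_gen O)).
Let CKS := CK_genP O.

Let nP w : nrm (P w) <= 1.
Proof. exact/nrm_projection_le1/cylproj_proj/CKS. Qed.

Let nMP x w : nrm (x * P w) <= nrm x.
Proof.
by apply: le_trans (nrmM _ _) _; have := nP w; have := nrm_ge0 x; nra.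
Qed.

Lemma cylproj_comm v w : P v * P w = P w * P v.
Proof.
wlog vw : v w / (size v <= size w)%N.
  by move=> W; case/orP: (leq_total (size v) (size w)) => /W.
have sa : star (P v * P w) = P v * P w.
  by rewrite (cylprojM M01 CKS vw); case: ifP => _; rewrite ?star_cylproj ?star0.
by rewrite -{1}sa starM !star_cylproj.
Qed.

(** Both properties pass to sums, products, adjoints and limits, and hold for the
    projections that generate the diagonal; the first is what makes the second
    stable under adjoints. *)
Lemma diagonal_almost_scalar x : CK_diagonal O x ->
  (forall v, x * P v = P v * x) /\
  (forall e : R, 0 < e -> exists n, forall w, (n <= size w)%N ->
     exists c : R[i], nrm (x * P w - c *: P w) < e).
Proof.
pose comm x := forall v, x * P v = P v * x.
pose loc x := forall e : R, 0 < e -> exists n, forall w, (n <= size w)%N ->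
     exists c : R[i], nrm (x * P w - c *: P w) < e.
have sub_comm : cstar_subalgebra comm.
  split.
  - by move=> v; rewrite mul0r mulr0.
  - by move=> a y z yC zC v; rewrite mulrDl mulrDr -scalerAl -scalerAr yC zC.
  - by move=> y z yC zC v; rewrite -mulrA zC mulrA yC mulrA.
  - by move=> y yC v; rewrite -(star_cylproj _ v) -!starM yC.
  apply/closed_nrmP => y yD v; apply/eqP; rewrite -subr_eq0; apply/eqP/nrm_eq0/eqP.
  rewrite eq_le nrm_ge0 andbT; apply/ler_addgt0Pl => e e0; rewrite addr0.
  have [|z zC yz] := yD (e / 2); first by lra.
  have -> : y * P v - P v * y = (y - z) * P v - P v * (y - z).
    by rewrite mulrBl mulrBr zC opprB addrC subrKA addrC.
  apply: le_trans (nrmB _ _) _; have := nMP (y - z) v; have := nrmM (P v) (y - z).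
  by have := nP v; have := nrm_ge0 (y - z); nra.
have sub_loc : cstar_subalgebra (comm `&` loc).
  have [C0 Clin Cmul Cstar Ccl] := sub_comm; split.
  - split=> // e e0; exists 0%N => w _; exists 0.
    by rewrite mul0r scale0r subrr nrm0.
  - move=> a y z [yC yL] [zC zL]; split=> [|e e0]; first exact: Clin.
    have a0 : 0 <= complex.Re `|a| by rewrite -ler0c RRe_real ?normr_real.
    have [|n1 n1P] := yL (e / (2 * (complex.Re `|a| + 1))).
      by rewrite divr_gt0//; lra.
    have [|n2 n2P] := zL (e / 2); first by lra.
    exists (maxn n1 n2) => w; rewrite geq_max => /andP[/n1P[c1 y1] /n2P[c2 z2]].
    exists (a * c1 + c2).
    rewrite mulrDl -scalerAl scalerDl -scalerA opprD addrACA -scalerBr.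
    apply: le_lt_trans (nrmD _ _) _; rewrite nrmZ.
    move: y1; rewrite ltr_pdivlMr; last by lra.
    by have := nrm_ge0 (y * P w - c1 *: P w); nra.
  - move=> y z [yC yL] [zC zL]; split=> [|e e0]; first exact: Cmul.
    have y0 := nrm_ge0 y; have z0 := nrm_ge0 z.
    have [|n1 n1P] := zL (Num.min 1 (e / (2 * (nrm y + 1)))).
      by rewrite lt_min ltr01 divr_gt0//; lra.
    have [|n2 n2P] := yL (e / (2 * (nrm z + 2))); first by rewrite divr_gt0//; lra.
    exists (maxn n1 n2) => w; rewrite geq_max => /andP[/n1P[c1 z1] /n2P[c2 y2]].
    exists (c2 * c1).
    have -> : y * z * P w - (c2 * c1) *: P w =
        y * (z * P w - c1 *: P w) + (y * P w - c2 *: P w) * (c1 *: P w).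
      have PP : P w * P w = P w by have [] := cylproj_proj M01 CKS w.
      rewrite -scalerAr mulrBl -(mulrA y (P w)) -scalerAl PP scalerBr scalerA.
      by rewrite mulrBr -scalerAr (mulrA y z) addrA subrK (mulrC c2).
    have c1P : nrm (c1 *: P w) <= nrm z + 1.
      have := nrmB (z * P w) (z * P w - c1 *: P w); rewrite opprB addrC subrK.
      move: z1; rewrite lt_min => /andP[z1 _].
      by have := nMP z w; lra.
    move: z1 y2; rewrite lt_min => /andP[_]; rewrite !ltr_pdivlMr; [|lra|lra].
    move=> z1 y2; apply: le_lt_trans (nrmD _ _) _.
    have := nrmM y (z * P w - c1 *: P w).
    have := nrmM (y * P w - c2 *: P w) (c1 *: P w).
    have := nrm_ge0 (z * P w - c1 *: P w); have := nrm_ge0 (y * P w - c2 *: P w).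
    have := nrm_ge0 (c1 *: P w).
    nra.
  - move=> y [yC yL]; split=> [|e /yL[n nP']]; first exact: Cstar.
    exists n => w /nP'[c yc]; exists (conjc c).
    rewrite (_ : _ - _ = star (y * P w - c *: P w)) ?nrm_star//.
    by rewrite starB starZ star_cylproj yC starM star_cylproj.
  apply/closed_nrmP => y yD; split.
    by move/closed_nrmP: Ccl; apply => e /yD[z [zC _] yz]; exists z.
  move=> e e0; have [|z [_ zL] yz] := yD (e / 2); first by lra.
  have [|n nP'] := zL (e / 2); first by lra.
  exists n => w /nP'[c zc]; exists c.
  apply: le_lt_trans (nrm_split (z * P w) _ _) _; rewrite -mulrBl.
  by have := nMP (y - z) w; lra.
move=> /(_ (comm `&` loc)); apply; split=> // _ [v _ ->].
rewrite -[_ * _]/(P v); split; first by move=> w; exact: cylproj_comm.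
move=> e e0; exists (size v) => w vw; rewrite (cylprojM M01 CKS vw).
by case: ifP => _; [exists 1|exists 0]; rewrite ?scale1r ?scale0r subrr nrm0.
Qed.

(** A projection at distance less than 1/2 from a scalar is 0 or 1; this is applied
    below [P w]. *)
Lemma diagonal_projection q : CK_diagonal O q -> projection q ->
  exists m, forall w, (m <= size w)%N -> P w * q = 0 \/ P w * q = P w.
Proof.
move=> /diagonal_almost_scalar[qC qL] pq; have [|m mP] := qL 2^-1; first by rewrite invr_gt0.
exists m => w /mP[c qc]; have pw := cylproj_proj M01 CKS w.
have [sw ww] := pw; have [sq qq] := pq.
pose r := P w * q; have rE : q * P w = r by exact: qC.
have pr : projection r by apply: projectionM.
have Pr : P w * r = r by rewrite mulrA ww.
have rP : r * P w = r by rewrite -mulrA qC mulrA ww.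
have ps : projection (P w - r) by exact: projectionB.
have [/eqP r0|r0] := boolP (r == 0); first by left.
have [|s0] := boolP (P w - r == 0); first by rewrite subr_eq0 => /eqP Pw; right; exact: esym.
have n1 : nrm ((1 - c) *: r) < 2^-1.
  have -> : (1 - c) *: r = r * (q * P w - c *: P w).
    by rewrite rE mulrBr -scalerAr pr.2 rP scalerBl scale1r.
  apply: le_lt_trans (nrmM _ _) _; rewrite (nrm_projection pr r0) mul1r; exact: qc.
have n2 : nrm (c *: (P w - r)) < 2^-1.
  have -> : c *: (P w - r) = - ((P w - r) * (q * P w - c *: P w)).
    rewrite rE mulrBr -scalerAr !mulrBl pr.2 Pr rP ww subrr sub0r opprK.
    by [].
  rewrite nrmN; apply: le_lt_trans (nrmM _ _) _.
  by rewrite (nrm_projection ps s0) mul1r; exact: qc.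
move: n1 n2; rewrite !nrmZ (nrm_projection pr r0) (nrm_projection ps s0) => n1 n2.
have := @nrmD R O ((1 - c) *: 1) (c *: 1).
rewrite -scalerDl subrK scale1r !nrmZ nrm1 => n12; exfalso; lra.
Qed.

End DiagonalProjections.

(** * The homeomorphism dual to an isomorphism of diagonals *)

Section Dual.
Context {R : realType} {N N' : nat} {M : 'M[nat]_N} {M' : 'M[nat]_N'}.
Variables (O : CK_algebra (R := R) M) (O' : CK_algebra (R := R) M').
Hypotheses (M01 : zero_one_mx M) (M'01 : zero_one_mx M').
Hypothesis irrM : irreducible_mx M.
Local Notation P := (cylproj (CK_gen O)).
Local Notation P' := (cylproj (CK_gen O')).
Local Notation X := (shift_space M).
Local Notation X' := (shift_space M').
Variable g : {lrmorphism O' -> O}.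
Hypothesis gs : star_preserving g.
Hypothesis gD : forall q, CK_diagonal O' q -> CK_diagonal O (g q).

(** The projection [g (P' w)] of the diagonal stands for a clopen set, and
    [covers x w] says that [x] belongs to it. *)
Definition covers (x : X) w := exists m, P (word x m) * g (P' w) = P (word x m).

Lemma cylproj_word_mul (x : X) m n : (m <= n)%N ->
  P (word x n) * P (word x m) = P (word x n).
Proof.
move=> mn; rewrite (cylproj_comm _ M01) (cylprojM M01 (CK_genP O)) !size_word//.
by rewrite take_word// eqxx.
Qed.

Lemma cylproj_word_neq0 (x : X) n : P (word x n) != 0.
Proof. exact: (cylproj_neq0 M01 (CK_genP O) irrM (sorted_word x n)). Qed.

Lemma word_absorb (x : X) m n (q : O) : (m <= n)%N ->
  P (word x m) * q = P (word x m) -> P (word x n) * q = P (word x n).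
Proof. by move=> mn xq; rewrite -(cylproj_word_mul x mn) -mulrA xq. Qed.

Let g_proj w : projection (g (P' w)).
Proof.
have [sP PP] := cylproj_proj M'01 (CK_genP O') w.
by split; [rewrite -gs sP|rewrite -rmorphM PP].
Qed.

Lemma covers_nil x : covers x [::].
Proof. by exists 0%N; rewrite /cylproj monom_nil star1 mulr1 rmorph1 mulr1. Qed.

(** The projections [g (P' (rcons w j))] sum to [g (P' w)], and a small cylinder
    around [x] is contained in, or disjoint from, each of the corresponding sets. *)
Lemma covers_rcons x w : covers x w -> exists j, covers x (rcons w j).
Proof.
move=> [m xw].
have /choice[k kP] j : exists k, forall n, (k <= n)%N ->
    P (word x n) * g (P' (rcons w j)) = 0 \/
    P (word x n) * g (P' (rcons w j)) = P (word x n).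
  have [|k kP] := diagonal_projection M01 _ (g_proj (rcons w j)).
    by apply: gD; apply: diagonal_cylproj; case: (w).
  by exists k => n kn; apply: kP; rewrite size_word.
pose n := maxn m (\max_j k j); apply: contrapT => /forallNP no.
have /eqP[] := cylproj_word_neq0 x n.
rewrite -(word_absorb (leq_maxl _ _) xw) (cylproj_rcons (CK_genP O')) rmorph_sum.
rewrite mulr_sumr big1// => j _.
have [|//|xj] := kP j n.
  by apply: leq_trans (leq_maxr _ _); exact: (leq_bigmax j).
by case: (no j); exists n.
Qed.

Lemma covers_sorted x w : covers x w -> sorted (arrow M') w.
Proof.
move=> [m xw]; apply: (cylproj_sorted M'01 (CK_genP O')).
apply: contra_neq (cylproj_word_neq0 x m) => w0.
by rewrite -xw w0 raddf0 mulr0.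
Qed.

Lemma covers_inj x v w : size v = size w -> covers x v -> covers x w -> v = w.
Proof.
move=> vw [m xv] [n xw]; apply: contrapT => /eqP ne.
have /eqP[] := cylproj_word_neq0 x (maxn m n).
rewrite -(word_absorb (leq_maxr _ _) xw) -(word_absorb (leq_maxl _ _) xv).
rewrite -mulrA -rmorphM (cylprojM M'01 (CK_genP O')) ?vw//.
by rewrite -vw take_oversize ?vw// eq_sym (negbTE ne) raddf0 mulr0.
Qed.

Lemma dual_point x : exists y : X', forall n, covers x (word y n).
Proof.
have [j0 _] := covers_rcons (covers_nil x).
have /choice[f fP] w : exists j, covers x w -> covers x (rcons w j).
  have [/covers_rcons[j xj]|nc] := pselect (covers x w); first by exists j.
  by exists j0.
pose W n := iter n (fun w => rcons w (f w)) [::]; pose s n := f (W n).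
have cW n : covers x (W n) by elim: n => [|n /fP//]; exact: covers_nil.
have WE n : W n = mkseq s n by elim: n => // n IH; rewrite mkseqS -IH.
have Ms n : M' (s n) (s n.+1) = 1%N.
  have /(sortedP (s 0)) := covers_sorted (cW n.+2); rewrite WE size_mkseq.
  by move=> /(_ n (ltnSn _)); rewrite !nth_mkseq// => /eqP.
by exists (point Ms) => n; rewrite -[word _ _]/(mkseq s n) -WE.
Qed.

End Dual.

Section DualHomeomorphism.
Context {R : realType} {N N' : nat} {M : 'M[nat]_N} {M' : 'M[nat]_N'}.
Variables (O : CK_algebra (R := R) M) (O' : CK_algebra (R := R) M').
Hypotheses (M01 : zero_one_mx M) (M'01 : zero_one_mx M').
Hypotheses (irrM : irreducible_mx M) (irrM' : irreducible_mx M').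
Local Notation P := (cylproj (CK_gen O)).
Local Notation P' := (cylproj (CK_gen O')).
Local Notation X := (shift_space M).
Local Notation X' := (shift_space M').
Local Notation sft := (@Defs.shift _ M).
Local Notation sft' := (@Defs.shift _ M').
Variables (f : {lrmorphism O -> O'}) (g : {lrmorphism O' -> O}).
Hypotheses (fs : star_preserving f) (gs : star_preserving g).
Hypotheses (fK : cancel f g) (gK : cancel g f).
Hypothesis gD : forall q, CK_diagonal O' q -> CK_diagonal O (g q).
Variables (h : X -> X') (h' : X' -> X).
Hypothesis hP : forall x n, covers g x (word (h x) n).
Hypothesis h'P : forall y n, covers f y (word (h' y) n).

Lemma dual_continuous : continuous h.
Proof.
apply/continuous_agree => x n; have [m xm] := hP x n; exists m => y xy.
apply/word_agree; apply: (covers_inj M01 M'01 irrM _ _ (hP y n)).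
  by rewrite !size_word.
by exists m; move/word_agree: xy => <-.
Qed.

Lemma dual_cancel : cancel h h'.
Proof.
move=> x; apply/esym/agree_eq => l; apply/word_agree.
have [n yl] := h'P (h x) l; have [m xn] := hP x n.
have gy : g (P' (word (h x) n)) * P (word (h' (h x)) l) = g (P' (word (h x) n)).
  by have /(congr1 g) := yl; rewrite rmorphM/= fK.
have xl : P (word x m) * P (word (h' (h x)) l) = P (word x m).
  by rewrite -{1}xn -mulrA gy.
have := word_absorb M01 (leq_maxl m l) xl.
rewrite (cylproj_comm _ M01) (cylprojM M01 (CK_genP O)) !size_word ?leq_maxr//.
rewrite take_word ?leq_maxr//; case: ifP => [/eqP//|_ /esym/eqP].
by rewrite (negbTE (cylproj_word_neq0 _ M01 irrM _ _)).
Qed.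

(** The element [f (S i)], with [i] the first letter of [x], has degree one.  If [K]
    steps did not synchronise [h (sft x)] and [h x], it would be small between the
    cylinders around these points; but cut down to smaller cylinders it is the
    nonzero partial isometry [f (S i * P w)], of norm 1. *)
Lemma dual_lag : (forall t, f \o gauge O t =1 gauge O' t \o f) ->
  exists K, forall x, iter K sft' (h (sft x)) = iter K.+1 sft' (h x).
Proof.
move=> fgauge.
have /choice[k kP] i : exists K, forall z y, iter K sft' y <> iter K.+1 sft' z ->
    exists n, nrm (P' (word z n.+1) * f (CK_gen O i) * P' (word y n)) < 1.
  apply: degree_one_lag => // t.
  by rewrite -[LHS]/((gauge O' t \o f) _) -fgauge /= gauge_gen linearZ.
exists (\max_i k i)%N => x; set i := letter x 0.
suff lag : iter (k i) sft' (h (sft x)) = iter (k i).+1 sft' (h x).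
  have kK : (k i <= \max_i k i)%N by exact: (leq_bigmax i).
  by rewrite -(subnK kK) -addnS !iterD lag.
apply: contrapT => /kP[n]; apply/negP; rewrite -leNgt.
have [m1 xm1] := hP x n.+1; have [m2 xm2] := hP (sft x) n.
pose m := maxn m1 m2; pose w := word (sft x) m.
have wE : word x m.+1 = i :: w by rewrite word_cons.
have E1 : f (P (i :: w)) * P' (word (h x) n.+1) = f (P (i :: w)).
  rewrite -wE -[P' _]gK -rmorphM; congr (f _); apply: word_absorb xm1 => //.
  by rewrite leqW ?leq_maxl.
have E2 : P' (word (h (sft x)) n) * f (P w) = f (P w).
  have /(congr1 star) : f (P w) * P' (word (h (sft x)) n) = f (P w).
    rewrite -[P' _]gK -rmorphM; congr (f _); apply: word_absorb xm2 => //.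
    exact: leq_maxr.
  by rewrite starM -!fs !star_cylproj.
have pi w' : monom (CK_gen O) w' * star (monom (CK_gen O) w') * monom (CK_gen O) w' =
    monom (CK_gen O) w' := monom_partial_isometry M01 (CK_genP O) w'.
pose b := monom (CK_gen O) (i :: w) * star (monom (CK_gen O) w).
have bE : P (i :: w) * CK_gen O i * P w = b.
  rewrite -mulrA (mulrA (CK_gen O i)) -monom_cons mulrA.
  by rewrite /cylproj pi.
have bb : b * star b = P (i :: w).
  rewrite starM starK -mulrA (mulrA _ (monom _ w)) {1}monom_cons -mulrA.
  by rewrite (mulrA (monom _ w)) (mulrA (monom _ w)) pi mulrA -monom_cons.
have fP1 : nrm (f (P (i :: w))) = 1.
  apply: nrm_projection; first by split; rewrite -?fs ?star_cylproj// -rmorphM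
    (cylproj_proj M01 (CK_genP O) _).2.
  apply: contra_neq (cylproj_word_neq0 O M01 irrM x m.+1) => /(congr1 g).
  by rewrite fK raddf0 wE.
have nb : nrm (f b) = 1.
  apply/eqP; rewrite -(@eqrXn2 _ 2) ?nrm_ge0// expr1n -nrm_star -nrm_cstar starK.
  by rewrite -fs -rmorphM bb fP1.
have fPw : nrm (f (P w)) <= 1.
  apply: le_trans (starhom_contractive fs _) _.
  exact/nrm_projection_le1/cylproj_proj/CK_genP.
have -> : 1 = nrm (f (P (i :: w)) * f (CK_gen O i) * f (P w)).
  by rewrite -nb -bE 2!rmorphM.
rewrite -E1 -E2.
set Q := P' (word (h x) n.+1) * f (CK_gen O i) * P' (word (h (sft x)) n).
have -> : f (P (i :: w)) * P' (word (h x) n.+1) * f (CK_gen O i) *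
    (P' (word (h (sft x)) n) * f (P w)) = f (P (i :: w)) * Q * f (P w).
  by rewrite /Q !mulrA.
apply: le_trans (nrmM _ _) _; have := nrmM (f (P (i :: w))) Q; rewrite fP1.
by have := nrm_ge0 Q; have := nrm_ge0 (f (P (i :: w)) * Q); have := nrm_ge0 (f (P w)); nra.
Qed.

End DualHomeomorphism.

(** The inverse isomorphism is obtained from the universal property, applied to the
    preimages of the generators; both isomorphisms are then dualised. *)
Lemma iso_eventually_conjugate (R : realType) (N1 N2 : nat)
    (A : 'M[nat]_N1) (B : 'M[nat]_N2) (A01 : zero_one_mx A) (B01 : zero_one_mx B)
    (A_irr : irreducible_mx A) (B_irr : irreducible_mx B)
    (OA : CK_algebra (R := R) A) (OB : CK_algebra (R := R) B)
    (f : {lrmorphism OA -> OB}) :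
  bijective f -> star_preserving f ->
  f @` CK_diagonal OA = CK_diagonal OB ->
  (forall t : R, f \o gauge OA t =1 gauge OB t \o f) ->
  eventually_conjugate A B.
Proof.
move=> [g0 fK0 gK0] fs fD fgauge.
have CKg : CK_family B (fun j => g0 (CK_gen OB j)).
  have [pS sS rS] := CK_genP OB; have fI := can_inj fK0.
  split=> [i||i]; apply: fI.
  - by rewrite !rmorphM/= fs gK0 pS.
  - by rewrite rmorph_sum rmorph1 -sS; apply: eq_bigr => j _; rewrite rmorphM/= fs gK0.
  - rewrite rmorphM/= fs gK0 rS rmorph_sum; apply: eq_bigr => j _.
    by rewrite rmorphMn/= rmorphM/= fs gK0.
have [g [gs gE _]] := CK_universal OB CKg.
have gK : cancel g f.
  apply: (CK_hom_eq (f := f \o g) (g := idfun)) => //.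
    by move=> x; rewrite /= gs fs.
  by move=> i; rewrite /= gE gK0.
have fK : cancel f g by move=> x; apply: (can_inj fK0); rewrite gK.
have gD q : CK_diagonal OB q -> CK_diagonal OA (g q).
  by rewrite -fD => -[x Dx <-]; rewrite fK.
have fD' q : CK_diagonal OA q -> CK_diagonal OB (f q) by rewrite -fD; exists q.
have ggauge t : g \o gauge OB t =1 gauge OA t \o g.
  by move=> y; apply: (can_inj fK); rewrite /= gK -[f _]/((f \o gauge OA t) _) fgauge /= gK.
have /choice[h hP] := dual_point A01 B01 A_irr gs gD.
have /choice[h' h'P] := dual_point B01 A01 B_irr fs fD'.
have [K1 K1P] := dual_lag A01 B01 A_irr fs fK gK hP fgauge.
have [K2 K2P] := dual_lag B01 A01 B_irr gs gK fK h'P ggauge.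
exists h, h', (fun=> K1), (fun=> K2); split=> //; [split| |].
- exact: dual_cancel hP h'P.
- exact: dual_cancel h'P hP.
- exact: dual_continuous hP.
- exact: dual_continuous h'P.
- exact: cst_continuous.
- exact: cst_continuous.
Qed.

Theorem theorem1p2 (R : realType) (N1 N2 : nat)
    (A : 'M[nat]_N1) (B : 'M[nat]_N2)
    (N1_gt1 : (1 < N1)%N) (N2_gt1 : (1 < N2)%N)
    (A01 : zero_one_mx A) (B01 : zero_one_mx B)
    (A_irr : irreducible_mx A) (B_irr : irreducible_mx B)
    (A_nperm : ~~ is_perm_mx A) (B_nperm : ~~ is_perm_mx B)
    (OA : CK_algebra (R := R) A) (OB : CK_algebra (R := R) B) :
  (exists Phi : {lrmorphism OA -> OB},
     [/\ bijective Phi,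
         star_preserving Phi,
         Phi @` CK_diagonal OA = CK_diagonal OB
       & forall t : R, Phi \o gauge OA t =1 gauge OB t \o Phi])
  <-> eventually_conjugate A B.
Proof.
split=> [[Phi [bij sPhi DPhi gPhi]]|].
  exact: iso_eventually_conjugate bij sPhi DPhi gPhi.
by apply: eventually_conjugate_iso => // i; exact: irreducible_arrow.
Qed.
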